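(* Let $\mu\in\mathcal M(\mathbb R^{d-1})$ and let $\mu(d\bar x)=f(\bar x)\omega_\alpha(d\bar x)+\nu(d\bar x)$ be the Lebesgue decomposition of $\mu$ with respect to $\omega_\alpha$. Then $M_{\mathbb H}[\mu]$ has the nontangential limit $f(\bar y)$ at almost every $y=(\bar y,0)\in\mathbf L$ with respect to $(d-1)$-dimensional Lebesgue measure.
   Context: Let $d\ge2$, $\alpha\in(1,2)$. Write $x=(\bar x,x_d)\in\mathbb R^{d-1}\times\mathbb R$, $\mathbf L=\{x\in\mathbb R^d:x_d=0\}$ (identified with $\mathbb R^{d-1}$), $\mathbb H=\mathbb R^d\setminus\mathbf L$, $e_d=(0,\dots,0,1)$. $\mathcal M(\mathbb R^{d-1})$ is the space of finite signed Borel measures on $\mathbb R^{d-1}$. Let $\mathcal C_3=\pi^{(1-d)/2}\Gamma((\alpha+d)/2-1)/\Gamma((\alpha-1)/2)$ and $\omega_\alpha(d\bar x)=\mathcal C_3|e_d-(\bar x,0)|^{-(d+\alpha-2)}d\bar x$ (a probability measure on $\mathbb R^{d-1}$). Let $M_{\mathbb H}(x,\bar y)=\frac{|x_d|^{\alpha-1}|e_d-(\bar y,0)|^{d+\alpha-2}}{|x-(\bar y,0)|^{d+\alpha-2}}$ for $x\in\mathbb H,\bar y\in\mathbb R^{d-1}$, and $M_{\mathbb H}[\mu](x)=\int_{\mathbb R^{d-1}}M_{\mathbb H}(x,\bar y)\mu(d\bar y)$. For $y\in\mathbf L$ and $\beta>0$ let $\Gamma_\beta(y)=\{x\in\mathbb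 H:|x-y|<(1+\beta)|x_d|\}$; a function $u$ on $\mathbb H$ has nontangential limit $L$ at $y$ if for every $\beta>0$, $\lim_{\Gamma_\beta(y)\ni x\to y}u(x)=L$. *)

(* Defs.v *)
From HB Require Import structures.
From mathcomp Require Import all_boot all_order all_algebra.
From mathcomp Require Import all_classical all_reals all_analysis.

Import Order.TTheory GRing.Theory Num.Theory.
Import numFieldNormedType.Exports.
Local Open Scope classical_set_scope.
Local Open Scope ring_scope.

(* R^n is modelled as n.-tuple R, with the product (= Borel) sigma-algebra
   provided by MathComp-Analysis. A point x of R^d = R^(d-1) x R is a pair
   (xb, t) with xb : (d.-1).-tuple R and t = x_d. *)

Section defs.
Context {R : realType}.

Definition sqnorm {n} (x : n.-tuple R) : R := \sum_(i < n) (tnth x i) ^+ 2.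
Definition sqdist {n} (x y : n.-tuple R) : R :=
  \sum_(i < n) (tnth x i - tnth y i) ^+ 2.

(* Euclidean distance in R^d between (xb, t) and (yb, 0) *)
Definition distL {n} (xb : n.-tuple R) (t : R) (yb : n.-tuple R) : R :=
  Num.sqrt (sqdist xb yb + t ^+ 2).

(* |e_d - (yb,0)| *)
Definition dist_ed {n} (yb : n.-tuple R) : R := Num.sqrt (sqnorm yb + 1).

(* Lebesgue measure on R^n: a measure on the Borel sets of R^n giving every
   box ]a,b] its volume (this characterizes it uniquely). *)
Definition is_lebesgue_measure {n} (leb : {measure set (n.-tuple R) -> \bar R}) :=
  forall a b : n.-tuple R, (forall i, tnth a i <= tnth b i) ->
    leb [set x | forall i, tnth a i < tnth x i <= tnth b i] =
    (\prod_(i < n) (tnth b i - tnth a i))%:E.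

Definition Gamma (s : R) : R :=
  fine (\int[@lebesgue_measure R]_(t in `]0%R, +oo[%classic)
          (t `^ (s - 1) * expR (- t))%:E)%E.

Definition C3 (d : nat) (alpha : R) : R :=
  pi `^ ((1 - d%:R) / 2) * Gamma ((alpha + d%:R) / 2 - 1)
    / Gamma ((alpha - 1) / 2).

Definition omega_density (d : nat) (alpha : R) (xb : (d.-1).-tuple R) : R :=
  C3 d alpha * (dist_ed xb) `^ (- (d%:R + alpha - 2)).

Definition MH_kernel (d : nat) (alpha : R) (xb : (d.-1).-tuple R) (t : R)
  (yb : (d.-1).-tuple R) : R :=
  `|t| `^ (alpha - 1) * (dist_ed yb) `^ (d%:R + alpha - 2)
    / (distL xb t yb) `^ (d%:R + alpha - 2).

Definition hahn_pair {dd} {T : measurableType dd} (nu : {charge set T -> \bar R}) :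
  {PN : set T * set T | hahn_decomposition nu PN.1 PN.2}.
Proof.
apply: cid.
have [P [N h]] := Hahn_decomposition nu.
by exists (P, N).
Defined.

Definition charge_integral {dd} {T : measurableType dd}
  (nu : {charge set T -> \bar R}) (g : T -> R) : \bar R :=
  (\int[jordan_pos (projT2 (hahn_pair nu))]_x (g x)%:E
   - \int[jordan_neg (projT2 (hahn_pair nu))]_x (g x)%:E)%E.

Definition MH (d : nat) (alpha : R)
  (mu : {charge set ((d.-1).-tuple R) -> \bar R})
  (xb : (d.-1).-tuple R) (t : R) : R :=
  fine (charge_integral mu (MH_kernel d alpha xb t)).

Definition charge_singular {dd} {T : measurableType dd}
  (nu : {charge set T -> \bar R}) (om : {measure set T -> \bar R}) :=
  exists S, [/\ measurable S, om S = 0%E &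
    forall B, measurable B -> B `<=` ~` S -> nu B = 0%E].

Definition nontangential_limit {n} (u : n.-tuple R -> R -> R)
  (yb : n.-tuple R) (L : R) :=
  forall beta : R, 0 < beta ->
  forall eps : R, 0 < eps -> exists2 delta : R, 0 < delta &
    forall (xb : n.-tuple R) (t : R), t != 0 ->
      distL xb t yb < (1 + beta) * `|t| ->
      distL xb t yb < delta ->
      `|u xb t - L| < eps.

End defs.

(* Main.v *)
(* Write [mu = f omega + nu]. The Poisson-type kernel satisfies [M_H[omega] = 1], so for
   every rational q, [M_H[mu] - q] is the difference of [M_H[(f-q)^+ omega + nu^+]] and
   [M_H[(f-q)^- omega + nu^-]]. A finite measure giving no mass to a Borel set A has
   density zero (along small cubes) at Lebesgue-almost every point of A, by outer
   regularity and a Vitali covering argument; and M_H of a finite measure tends to 0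
   nontangentially at each point of zero density, by splitting the kernel dyadically.
   Taking A = {f <= q} (resp. {f >= q}) off the null set carrying nu, and letting q
   decrease (resp. increase) to f(y), gives the limit f(y). That [M_H[omega] = 1] comes
   from writing the kernel as a Gamma integral of Gaussians. *)
Require Import Defs.
From HB Require Import structures.
From mathcomp Require Import all_boot all_order all_algebra.
From mathcomp Require Import all_classical all_reals all_analysis.
From mathcomp Require Import measurable_realfun real_interval ring lra.
Import Order.TTheory GRing.Theory Num.Theory.
Import numFieldNormedType.Exports.
Local Open Scope classical_set_scope.
Local Open Scope ring_scope.

(** * Outer regularity of finite Borel measures *)

(** Each q gives only a one-sided bound. If q >= f(y), then [M_H[mu] - q] is at most the first of
    the two terms, because the second is nonnegative; the measure (f-q)^+ omega gives no mass to {f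
    <= q}, hence has zero density at almost every such y. Levels q <= f(y) give the lower bound in
    the same way. Keeping q rational keeps the union of the exceptional sets null. Two features of
    the statement shape the rest. Lebesgue measure is known only through the volumes of boxes, so
    integrals over R^(d-1) are rebuilt one coordinate at a time. And [MH] is defined by the Jordan
    parts of mu, which are not those of nu and f; it is reached through an identity between sums of
    nonnegative measures, and subtraction is legitimate because the kernel is bounded in its second
    variable, so that all the integrals are finite. *)

Section outer_regularity.
Context {R : realType} {n : nat}.
Local Notation V := (n.-tuple R).

(** Openness in the sup metric, written on coordinates: what is extracted from it later is a small
    cube around a point, contained in [U]. *)
Definition sup_open (U : set V) := forall x, U x ->
  exists2 r : R, 0 < r &
    forall z : V, (forall i, `|tnth z i - tnth x i| < r) -> U z.

Variable sigma : {finite_measure set V -> \bar R}.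

Definition outer_approx (A : set V) := measurable A /\
  forall e : R, 0 < e -> exists U, [/\ measurable U, sup_open U, A `<=` U &
    (sigma (U `\` A) <= e%:E)%E].

Lemma outer_approx_open U : measurable U -> sup_open U -> outer_approx U.
Proof.
move=> mU oU; split => // e e0; exists U; split => //.
by rewrite setDv measure0 lee_fin ltW.
Qed.

Lemma outer_approx_bigcup (A : (set V)^nat) :
  (forall k, outer_approx (A k)) -> outer_approx (\bigcup_k A k).
Proof.
move=> HA; have mA k : measurable (A k) by have [] := HA k.
split; first exact: bigcupT_measurable.
move=> e e0.
have /choice[U HU] k : exists U, [/\ measurable U, sup_open U, A k `<=` U &
    (sigma (U `\` A k) <= (e / (2 ^ k.+1)%:R)%:E)%E].
  have [_] := HA k; apply.
  by rewrite divr_gt0// ltr0n expn_gt0.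
have mU k : measurable (U k) by have [] := HU k.
exists (\bigcup_k U k); split.
- exact: bigcupT_measurable.
- move=> x [k _ Ux]; have [_ oU _ _] := HU k.
  have [r r0 hr] := oU x Ux; exists r => // z hz; exists k => //; exact: hr.
- by move=> x [k _ Ax]; exists k => //; have [_ _ + _] := HU k; apply.
- apply: (@le_trans _ _ (\sum_(k <oo) sigma (U k `\` A k))%E).
    apply: measure_sigma_subadditive => //.
    + by move=> k; exact: measurableD.
    + by apply: measurableD; exact: bigcupT_measurable.
    + move=> x [[k _ Ux] nA]; exists k => //; split => // Ax.
      by apply: nA; exists k.
  apply: le_trans (epsilon_trick0 predT (ltW e0)).
  apply: lee_nneseries => k _ //.
  by have [_ _ _] := HU k.
Qed.

Lemma outer_approxI A B : outer_approx A -> outer_approx B ->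
  outer_approx (A `&` B).
Proof.
move=> [mA HA] [mB HB]; split; first exact: measurableI.
move=> e e0; have e20 : 0 < e / 2 by rewrite divr_gt0.
have [U [mU oU AU sU]] := HA _ e20; have [W [mW oW BW sW]] := HB _ e20.
exists (U `&` W); split.
- exact: measurableI.
- move=> x [Ux Wx]; have [r r0 hr] := oU x Ux; have [s s0 hs] := oW x Wx.
  exists (Num.min r s); first by rewrite lt_min r0 s0.
  move=> z hz; split; [apply: hr|apply: hs] => i;
  by have := hz i; rewrite lt_min => /andP[].
- exact: setISS.
- apply: (@le_trans _ _ (sigma ((U `\` A) `|` (W `\` B)))).
    apply: le_measure; rewrite ?inE//.
    + by apply: measurableD; exact: measurableI.
    + by apply: measurableU; exact: measurableD.
    + move=> x [[Ux Wx] /not_andP[nA|nB]]; by [left|right].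
  apply: le_trans (measureU2 _ _ _) _; [exact: measurableD|exact: measurableD|].
  by rewrite [in leRHS](splitr e) EFinD leeD.
Qed.

(** The finite intersections [B k] decrease to the full one, and since [sigma] is finite their
    masses converge. Some [B k] is thus within e/2 of the intersection, and an open set within e/2
    of [B k] suffices. *)
Lemma outer_approx_bigcap (A : (set V)^nat) :
  (forall k, outer_approx (A k)) -> outer_approx (\bigcap_k A k).
Proof.
move=> HA; have mA k : measurable (A k) by have [] := HA k.
pose B k := \bigcap_(i < k.+1) A i.
have BE k : B k.+1 = B k `&` A k.+1.
  apply/seteqP; split => x.
    move=> h; split; last by apply: h => /=.
    by move=> i /= ik; apply: h => /=; exact: ltn_trans (ltnSn _).
  by move=> [h1 h2] i /=; rewrite ltnS leq_eqVlt => /predU1P[->//|]; exact: h1.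
have HB k : outer_approx (B k).
  elim: k => [|k ih]; last by rewrite BE; exact: outer_approxI.
  rewrite (_ : B 0%N = A 0%N)//; apply/seteqP; split => x; first by move=> h; exact: h.
  by move=> Ax i /=; rewrite ltnS leqn0 => /eqP ->.
have mB k : measurable (B k) by have [] := HB k.
have capE : \bigcap_k B k = \bigcap_k A k.
  apply/seteqP; split => x h k _; last by move=> i _; exact: h.
  by apply: (h k I) => /=.
have mcap : measurable (\bigcap_k A k) by exact: bigcapT_measurable.
split => // e e0; have e20 : 0 < e / 2 by rewrite divr_gt0.
have cvB : (sigma \o B) k @[k --> \oo] --> sigma (\bigcap_k A k).
  rewrite -capE; apply: nonincreasing_cvg_mu => //.
  - by rewrite ltey_eq fin_num_measure.
  - by rewrite capE.
  - move=> a b ab; apply/subsetPset => x h i /= ia; apply: h => /=.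
    exact: (leq_trans ia).
have [k hk] : exists k, (sigma (B k) <= sigma (\bigcap_k A k) + (e / 2)%:E)%E.
  have : (sigma (\bigcap_k A k) < sigma (\bigcap_k A k) + (e / 2)%:E)%E.
    by rewrite lteDl ?lte_fin// fin_num_measure.
  move=> h; have : \forall k \near \oo, (sigma (B k) < sigma (\bigcap_k A k) + (e / 2)%:E)%E.
    exact: (cvB _ (open_ereal_lt' h)).
  by case=> N _ /(_ N (leqnn N)) h'; exists N; exact: ltW.
have [U [mU oU BU sU]] := (HB k).2 _ e20.
have cB : \bigcap_k A k `<=` B k by move=> x h i _; exact: h.
exists U; split => //; first exact: subset_trans BU.
have -> : U `\` \bigcap_k A k = (U `\` B k) `|` (B k `\` \bigcap_k A k).
  apply/seteqP; split => x.
    move=> [Ux nA]; have [Bx|nB] := pselect (B k x); first by right.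
    by left.
  by move=> [[Ux nB]|[Bx nA]]; split => //; [move/cB|exact: BU].
apply: le_trans (measureU2 _ _ _) _; [exact: measurableD|exact: measurableD|].
rewrite [in leRHS](splitr e) EFinD leeD//.
rewrite measureD//; last by rewrite ltey_eq fin_num_measure.
rewrite leeBlDl; last by rewrite fin_num_measure//; exact: measurableI.
by rewrite setIidr.
Qed.

(** Asking for both sets makes the class stable under complement, so that it is a sigma-algebra and
    can be tested on generators. *)
Definition bi_approx A := outer_approx A /\ outer_approx (~` A).

Lemma bi_approx_sigma : sigma_algebra setT bi_approx.
Proof.
split.
- split; first by apply: outer_approx_open => // x [].
  by rewrite setC0; apply: outer_approx_open => // x _; exists 1.
- by move=> A [h1 h2]; rewrite setTD; split => //; rewrite setCK.
- move=> A HA; split; first by apply: outer_approx_bigcup => k; have [] := HA k.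
  by rewrite setC_bigcup; apply: outer_approx_bigcap => k; have [] := HA k.
Qed.

Lemma sup_open_tnth i (B : set R) : open B ->
  sup_open ((fun x : V => tnth x i) @^-1` B).
Proof.
rewrite openE => oB x Bx; have /nbhs_ballP[r r0 hr] := oB _ Bx.
by exists r => // z hz; apply: hr; rewrite /ball/= distrC; exact: hz.
Qed.

(** It suffices to treat the generating rays ]a, +oo[: these are open, and their complements ]-oo,
    a] are countable intersections of open rays. *)
Lemma bi_approx_tnth i (B : set R) : measurable B ->
  bi_approx ((fun x : V => tnth x i) @^-1` B).
Proof.
have mt (C : set R) : measurable C -> measurable ((fun x : V => tnth x i) @^-1` C).
  by move=> mC; rewrite -[X in measurable X]setTI; exact: measurable_tnth.
pose S := [set C : set R | bi_approx ((fun x : V => tnth x i) @^-1` C)].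
suff : measurable `<=` S by move=> h /h.
have -> : (measurable : set (set R)) = (@RGenOInfty.G R).-sigma.-measurable.
  exact: RGenOInfty.measurableE.
apply: smallest_sub.
  have [h0 hC hU] := bi_approx_sigma; split.
  - by rewrite /S/= preimage_set0.
  - by move=> C SC; rewrite /S/= setTD preimage_setC -setTD; exact: hC.
  - by move=> C SC; rewrite /S/= preimage_bigcup; exact: hU.
move=> _ [a ->]; rewrite /S/=; split.
  by apply: outer_approx_open; [exact: mt|exact: sup_open_tnth].
rewrite preimage_setC setCitvr.
have -> : `]-oo, a]%classic = \bigcap_k `]-oo, (a + k.+1%:R^-1)[%classic.
  by rewrite -(itvNycEbigcap true).
rewrite preimage_bigcap; apply: outer_approx_bigcap => k.
by apply: outer_approx_open; [exact: mt|apply: sup_open_tnth].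
Qed.

Lemma outer_regular A : measurable A -> outer_approx A.
Proof.
move=> mA; suff : bi_approx A by case.
move: A mA; apply: smallest_sub; first exact: bi_approx_sigma.
move=> A; rewrite -bigcup_seq => -[i _ [B mB <-]]; rewrite setTI.
exact: bi_approx_tnth.
Qed.

End outer_regularity.

(** * Cubes and the Vitali covering argument *)

Section cubes.
Context {R : realType} {n : nat}.
Local Notation V := (n.-tuple R).

(** Half-open, with half-side [r], so that [is_lebesgue_measure] applies to it directly. *)
Definition cube (c : V) (r : R) : set V :=
  [set x | forall i, tnth c i - r < tnth x i <= tnth c i + r].

Lemma measurable_cube c r : measurable (cube c r).
Proof.
have -> : cube c r = \big[setI/setT]_(i < n)
    ((fun x : V => tnth x i) @^-1` `]tnth c i - r, tnth c i + r]%classic).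
  rewrite -bigcap_seq; apply/seteqP; split => x h i //.
    by move=> _ /=; rewrite in_itv/=; exact: h.
  by have := h i (mem_index_enum i); rewrite /= in_itv.
apply: big_ind => //; first exact: measurableI.
move=> i _; rewrite -[X in measurable X]setTI; exact: measurable_tnth.
Qed.

Lemma cube_set0 c r : (0 < n)%N -> r <= 0 -> cube c r = set0.
Proof.
move=> n0 r0; rewrite -subset0 => x /(_ (Ordinal n0)) /andP[h1 h2].
by have := lt_le_trans h1 h2; lra.
Qed.

Lemma cube_triple c r c' r' z : r' <= r -> cube c r z -> cube c' r' z ->
  cube c' r' `<=` cube c (3 * r).
Proof.
move=> rr hz hz' x hx i; have := hz i; have := hz' i; have := hx i; lra.
Qed.

Lemma lebesgue_cube (leb : {measure set V -> \bar R}) c r :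
  is_lebesgue_measure leb -> 0 <= r -> leb (cube c r) = ((2 * r) ^+ n)%:E.
Proof.
move=> Hleb r0.
have := Hleb [tuple tnth c i - r | i < n] [tuple tnth c i + r | i < n].
have -> : [set x : V | forall i, tnth [tuple tnth c i - r | i < n] i < tnth x i <=
   tnth [tuple tnth c i + r | i < n] i] = cube c r.
  by apply/seteqP; split => x h i; have := h i; rewrite !tnth_mktuple.
move=> ->; last by move=> i; rewrite !tnth_mktuple; lra.
congr EFin; rewrite (eq_bigr (fun=> 2 * r)); last first.
  by move=> i _; rewrite !tnth_mktuple; ring.
by rewrite prodr_const card_ord.
Qed.

(* Greedy Vitali selection: the largest cube Q is kept, the cubes meeting it lie
   in 3Q, and the remaining ones are handled inside [W `\` Q]. *)
Lemma vitali_cubes (leb : {measure set V -> \bar R})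
    (sigma : {finite_measure set V -> \bar R}) (K : R) (s : seq (V * R)) :
  is_lebesgue_measure leb -> (0 < n)%N -> 0 <= K -> forall W, measurable W ->
  (forall p, p \in s -> cube p.1 p.2 `<=` W) ->
  (forall p, p \in s -> (leb (cube p.1 p.2) <= K%:E * sigma (cube p.1 p.2))%E) ->
  (leb (\big[setU/set0]_(p <- s) cube p.1 p.2)
    <= (K * 3 ^+ n)%:E * sigma W)%E.
Proof.
move=> Hleb n0 K0; move: {2}(size s) (leqnn (size s)) => m.
elim: m s => [|m IH] s sm W mW sW sK.
  move: sm sW sK; rewrite leqn0 size_eq0 => /eqP -> _ _.
  by rewrite big_nil measure0 mule_ge0// lee_fin mulr_ge0// exprn_ge0.
have [s0|[p0 p0s]] : s = [::] \/ exists p, p \in s.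
  by case: (s) => [|p s']; [left|right; exists p; rewrite mem_head].
  by apply: IH => //; rewrite s0.
have [q qs qmax] : exists2 q, q \in s & forall p, p \in s -> p.2 <= q.2.
  elim: (s) p0 p0s {sm sW sK} => [//|a t ih] _ _.
  have [->|[b bt]] : t = [::] \/ exists p, p \in t.
    by case: (t) => [|p s']; [left|right; exists p; rewrite mem_head].
    by exists a; rewrite ?mem_head// => p; rewrite inE => /eqP ->.
  have [q qt hq] := ih _ bt; have [aq|qa] := leP a.2 q.2.
    exists q; first by rewrite inE qt orbT.
    by move=> p; rewrite inE => /predU1P[->//|]; exact: hq.
  exists a; first by rewrite mem_head.
  move=> p; rewrite inE => /predU1P[->//|/hq pq]; exact: le_trans (ltW qa).
(* If the largest half-side is not positive, all the cubes are empty. *)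
have [q20|q20] := leP q.2 0.
  rewrite big_seq (eq_bigr (fun=> set0)); last first.
    by move=> p /qmax pq; rewrite cube_set0// (le_trans pq).
  rewrite big1//.
  by rewrite measure0 mule_ge0// lee_fin mulr_ge0// exprn_ge0.
pose Q := cube q.1 q.2; pose far (p : V * R) := `[< Q `&` cube p.1 p.2 = set0 >].
have mQ : measurable Q by exact: measurable_cube.
have QW : Q `<=` W by exact: sW.
pose s' := [seq p <- s | far p].
have s'm : (size s' <= m)%N.
  rewrite -ltnS (leq_trans _ sm)// size_filter -(count_predC far) -addn1 leq_add2l.
  rewrite -has_count; apply/hasP; exists q => //=.
  (* [Q] has positive volume, so it meets itself and is removed from the list: this is what makes
     the induction decrease. *)
  apply/negP => /asboolP; rewrite setIid => Q0.
  have := lebesgue_cube leb q.1 q.2 Hleb (ltW q20); rewrite -/Q Q0 measure0.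
  by move=> [] /esym/eqP; rewrite expf_eq0 mulf_eq0 (gt_eqF q20) pnatr_eq0 andbF.
have sub : \big[setU/set0]_(p <- s) cube p.1 p.2 `<=`
    cube q.1 (3 * q.2) `|` \big[setU/set0]_(p <- s') cube p.1 p.2.
  rewrite -!bigcup_seq => x [p /= ps px].
  have [pfar|pnear] := boolP (far p).
    by right; exists p => //=; rewrite mem_filter pfar.
  left; move/asboolPn : pnear => /eqP/set0P[z [Qz pz]].
  exact: (cube_triple _ _ _ _ _ (qmax p ps) Qz pz).
have mb (t : seq (V * R)) : measurable (\big[setU/set0]_(p <- t) cube p.1 p.2).
  by apply: bigsetU_measurable => p _; exact: measurable_cube.
apply: (@le_trans _ _ (leb (cube q.1 (3 * q.2) `|`
    \big[setU/set0]_(p <- s') cube p.1 p.2))).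
  apply: le_measure; rewrite ?inE//.
  by apply: measurableU => //; exact: measurable_cube.
apply: le_trans (measureU2 _ (measurable_cube _ _) (mb _)) _.
(* The mass of [Q] pays for the tripled cube and that of the complement pays for the far cubes, so
   no mass is counted twice. *)
have sWE : sigma W = (sigma Q + sigma (W `\` Q))%E.
  rewrite -measureU//; [|exact: measurableD|by rewrite setIC setDKI].
  by rewrite setDUK.
rewrite sWE ge0_muleDr//; apply: leeD.
  have q30 : 0 <= 3 * q.2 by rewrite mulr_ge0// ltW.
  rewrite [leLHS](_ : _ = ((2 * (3 * q.2)) ^+ n)%:E); last exact: lebesgue_cube.
  rewrite mulrCA exprMn (mulrC K) EFinM [X in (_ <= X * _)%E]EFinM -muleA.
  rewrite lee_wpmul2l ?lee_fin ?exprn_ge0//.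
  by rewrite -(lebesgue_cube leb q.1 _ Hleb (ltW q20)); exact: sK.
apply: IH => //; first exact: measurableD.
- move=> p; rewrite mem_filter => /andP[/asboolP far_p ps] x px; split.
    exact: sW px.
  by move=> Qx; have : (Q `&` cube p.1 p.2) x by []; rewrite far_p.
- by move=> p; rewrite mem_filter => /andP[_ ps]; exact: sK.
Qed.

End cubes.

(** * Points of zero density *)

Section zero_density.
Context {R : realType} {n : nat}.
Local Notation V := (n.-tuple R).

(** The derivative of [sigma] with respect to Lebesgue measure vanishes at [y] along cubes
    containing [y], centred there or not; the factor 2^n of the volume is absorbed in [e]. *)
Definition zero_density (sigma : set V -> \bar R) (y : V) :=
  forall e : R, 0 < e -> exists2 r0 : R, 0 < r0 &
    forall c r, 0 < r < r0 -> cube c r y -> (sigma (cube c r) <= (e * r ^+ n)%:E)%E.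

(** A countable family of cubes: unions of its members are measurable, and are limits of the finite
    unions that the Vitali bound handles. *)
Definition rat_cube (p : n.-tuple rat * rat) : set V :=
  cube [tuple ratr (tnth p.1 i) | i < n] (ratr p.2).

Lemma rat_cube_cover c r : 0 < r -> exists p : n.-tuple rat * rat,
  [/\ 0 < ratr p.2 :> R, ratr p.2 <= 2 * r & cube c r `<=` rat_cube p].
Proof.
move=> r0.
have /choice[q hq] i : exists q : rat,
    ratr q \in `](tnth c i - r / 4), (tnth c i + r / 4)[.
  by have [|q hq] := @rat_in_itvoo R (tnth c i - r / 4) (tnth c i + r / 4);
    [lra|exists q].
have [|h hh] := @rat_in_itvoo R (5 / 4 * r) (2 * r); first lra.
move: hh; rewrite in_itv/= => /andP[h1 h2].
exists ([tuple q i | i < n], h); split => /=; [lra|lra|].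
move=> x hx i; rewrite !tnth_mktuple.
have := hx i; have := hq i; rewrite in_itv/=; lra.
Qed.

Lemma leb_bigcup_le (leb : {measure set V -> \bar R}) (F : (set V)^nat) M :
  (forall k, measurable (F k)) ->
  (forall N, leb (\big[setU/set0]_(i < N) F i) <= M)%E ->
  (leb (\bigcup_k F k) <= M)%E.
Proof.
move=> mF HM.
have mB N : measurable (\big[setU/set0]_(i < N) F i) by exact: bigsetU_measurable.
have cv : (leb \o (fun N => \big[setU/set0]_(i < N.+1) F i)) N @[N --> \oo] -->
    leb (\bigcup_k F k).
  rewrite -bigcup_bigsetU_bigcup; apply: nondecreasing_cvg_mu => //.
    exact: bigcupT_measurable.
  by apply/nondecreasing_seqP => N; apply/subsetPset => x Fx; rewrite big_ord_recr/=; left.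
rewrite -(cvg_lim _ cv)//; apply: lime_le; first by apply/cvg_ex; eexists; exact: cv.
by apply: nearW => N; exact: HM.
Qed.

Context (leb : {measure set V -> \bar R}) (sigma : {finite_measure set V -> \bar R}).
Hypotheses (Hleb : is_lebesgue_measure leb) (n0 : (0 < n)%N).

(** Arbitrarily small cubes around [y] have density at least of order 1/(k+1). The union over [k]
    contains all points where [zero_density] fails. *)
Definition dense_at (k : nat) : set V := [set y | forall r0 : R, 0 < r0 ->
  exists c r, [/\ 0 < r < r0, cube c r y &
    ((k.+1%:R^-1 * r ^+ n)%:E < sigma (cube c r))%E]].

(** An open [U] around [A] has mass at most [e]. Every dense point of [A] lies in a rational cube
    inside [U] whose volume is at most [K] times its mass, and the Vitali bound gives the union of
    these cubes volume at most 3^n K e. The cover [W] stands in for a set not known to be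
    measurable. *)
Lemma dense_at_cover (A : set V) k (e : R) : measurable A -> sigma A = 0%E ->
  0 < e -> exists W, [/\ measurable W, A `&` dense_at k `<=` W &
    (leb W <= (4 ^+ n * k.+1%:R * 3 ^+ n * e)%:E)%E].
Proof.
move=> mA sA e0; have [_ /(_ e e0) [U [mU oU AU sU]]] := outer_regular sigma A mA.
have sUe : (sigma U <= e%:E)%E.
  rewrite -(setDUK AU) measureU//; first by rewrite [X in (X + _)%E](_ : _ = 0%E)// add0e.
    exact: measurableD.
  by rewrite setIC setDKI.
(* A cube of half-side s is enlarged to a rational one of half-side at most 2s, hence of volume at
   most 4^n s^n. *)
pose K : R := 4 ^+ n * k.+1%:R.
have K0 : 0 <= K by rewrite mulr_ge0// exprn_ge0.
pose good (p : n.-tuple rat * rat) :=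
  rat_cube p `<=` U /\ (leb (rat_cube p) <= K%:E * sigma (rat_cube p))%E.
(* Invalid codes and bad cubes are sent to half-side 0, which gives the empty cube since n > 0; the
   bounds then hold at every index. *)
pose P (i : nat) : V * R := if unpickle i is Some p then
  if `[< good p >] then ([tuple ratr (tnth p.1 i) | i < n], ratr p.2)
  else ([tuple 0 | i < n], 0) else ([tuple 0 | i < n], 0).
have P0 : (cube [tuple 0 | i < n] 0 : set V) = set0 by rewrite cube_set0.
have PU i : cube (P i).1 (P i).2 `<=` U.
  rewrite /P; case: unpickle => [p|]; last by rewrite P0.
  by case: asboolP => [[]//|_]; rewrite P0.
have PK i : (leb (cube (P i).1 (P i).2) <= K%:E * sigma (cube (P i).1 (P i).2))%E.
  rewrite /P; case: unpickle => [p|]; last by rewrite P0 !measure0 mule0.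
  by case: asboolP => [[]//|_]; rewrite P0 !measure0 mule0.
exists (\bigcup_i cube (P i).1 (P i).2); split.
- by apply: bigcupT_measurable => i; exact: measurable_cube.
- move=> y [Ay Dy]; have [r r0 Ur] := oU y (AU y Ay).
  (* The rational cube has side at most 4s < r and contains [y], so it stays within sup distance r
     of [y]. *)
  have [|c [s [/andP[s0 sr] cy cs]]] := Dy (r / 4); first by rewrite divr_gt0.
  have [p [p0 ps cp]] := rat_cube_cover c s s0.
  have gp : good p.
    split.
      move=> z hz; apply: Ur => i; have := hz i; have := cp _ cy i.
      by rewrite ltr_norml tnth_mktuple; lra.
    rewrite [leLHS](_ : _ = ((2 * ratr p.2) ^+ n)%:E); last first.
      by apply: lebesgue_cube => //; exact: ltW.
    apply: (@le_trans _ _ ((K * (k.+1%:R^-1 * s ^+ n))%:E)).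
      rewrite lee_fin /K -mulrA mulVKf ?pnatr_eq0// -exprMn; apply: lerXn2r.
      - by rewrite nnegrE mulr_ge0// ltW.
      - by rewrite nnegrE mulr_ge0// ltW.
      - lra.
    rewrite EFinM lee_wpmul2l ?lee_fin//.
    apply: (le_trans (ltW cs)); apply: le_measure; rewrite ?inE//;
      exact: measurable_cube.
  exists (pickle p) => //; rewrite /P pickleK asboolT//=; exact: cp.
- apply: leb_bigcup_le; first by move=> i; exact: measurable_cube.
  move=> N; rewrite -(big_mkord predT (fun i => cube (P i).1 (P i).2)).
  rewrite -(big_map P predT (fun p => cube p.1 p.2)).
  apply: le_trans (vitali_cubes leb sigma K _ Hleb n0 K0 U mU _ _) _.
  + by move=> _ /mapP[i _ ->]; exact: PU.
  + by move=> _ /mapP[i _ ->]; exact: PK.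
  + rewrite [leRHS]EFinM lee_wpmul2l// lee_fin mulr_ge0// exprn_ge0//.
Qed.

(** If zero density fails at [y] with tolerance [e], then [y] is in [dense_at k] as soon as 1/(k+1)
    <= e. Each [dense_at k] meets [A] in a null set, by covers of arbitrarily small volume. *)
Lemma zero_density_ae (A : set V) : measurable A -> sigma A = 0%E ->
  leb.-negligible (A `&` [set y | ~ zero_density sigma y]).
Proof.
move=> mA sA.
apply: (@negligibleS _ _ _ _ (\bigcup_k (A `&` dense_at k))).
  move=> y [Ay /existsNP[e /not_implyP[e0 /forall2NP hy]]].
  pose k := Num.truncn e^-1; exists k => //; split => // r0 r00.
  have [//|/existsNP[c /existsNP[r /not_implyP[hr /not_implyP[cy]]]]] := hy r0.
  move=> /negP; rewrite -ltNge => hs; exists c, r; split => //.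
  apply: le_lt_trans hs; rewrite lee_fin ler_wpM2r//.
    by case/andP: hr => r_gt0 _; rewrite exprn_ge0// ltW.
  by rewrite invf_ple ?posrE// ltW// truncnS_gt.
apply: negligible_bigcup => k.
pose C : R := 4 ^+ n * k.+1%:R * 3 ^+ n.
have C0 : 0 < C by rewrite !mulr_gt0// exprn_gt0.
have /choice[W HW] m : exists W, [/\ measurable W, A `&` dense_at k `<=` W &
    (leb W <= (m.+1%:R^-1)%:E)%E].
  have [|W [mW AW lW]] := dense_at_cover A k (C^-1 * m.+1%:R^-1) mA sA.
    by rewrite mulr_gt0 ?invr_gt0.
  exists W; split => //; move: lW; rewrite -/C mulrA mulfV ?gt_eqF// mul1r//.
have mW : measurable (\bigcap_m W m) by apply: bigcapT_measurable => m; case: (HW m).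
exists (\bigcap_m W m); split => //; last by move=> y hy m _; case: (HW m) => _ + _; exact.
apply/eqP; rewrite eq_le measure_ge0 andbT; apply/lee_addgt0Pr => e e0.
rewrite add0e; have [_ _] := HW (Num.truncn e^-1).
move=> h; apply: (@le_trans _ _ (leb (W (Num.truncn e^-1)))).
  apply: le_measure; rewrite ?inE//; first by case: (HW (Num.truncn e^-1)).
  exact: bigcap_inf.
apply: (le_trans h); rewrite lee_fin invf_ple ?posrE// ltW// truncnS_gt//.
Qed.

End zero_density.

(** * Estimates on the kernel *)

Section kernel.
Context {R : realType}.

Lemma ler_distL {n} (x y : n.-tuple R) t i : `|tnth x i - tnth y i| <= distL x t y.
Proof.
rewrite -sqrtr_sqr ler_wsqrtr// /sqdist (bigD1 i)//= -addrA lerDl.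
by rewrite addr_ge0// ?sqr_ge0// sumr_ge0// => j _; exact: sqr_ge0.
Qed.

Lemma ler_distL_height {n} (x y : n.-tuple R) t : `|t| <= distL x t y.
Proof.
rewrite -sqrtr_sqr ler_wsqrtr// lerDr /sqdist.
by rewrite sumr_ge0// => j _; exact: sqr_ge0.
Qed.

Lemma distL_gt0 {n} (x y : n.-tuple R) t : t != 0 -> 0 < distL x t y.
Proof. by rewrite -normr_gt0 => /lt_le_trans; apply; exact: ler_distL_height. Qed.

Lemma dist_ed_ge0 {n} (y : n.-tuple R) : 0 <= dist_ed y.
Proof. exact: sqrtr_ge0. Qed.

Lemma dist_ed_gt0 {n} (y : n.-tuple R) : 0 < dist_ed y.
Proof.
rewrite sqrtr_gt0 ltr_wpDl// /sqnorm sumr_ge0// => j _; exact: sqr_ge0.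
Qed.

Lemma dist_ed_le {n} (y : n.-tuple R) : dist_ed y <= 1 + \sum_(i < n) `|tnth y i|.
Proof.
have s0 : 0 <= \sum_(i < n) `|tnth y i| by exact: sumr_ge0.
rewrite -[leRHS]ger0_norm ?addr_ge0// -sqrtr_sqr ler_wsqrtr//.
set S := \sum_(i < n) _ in s0 *.
have : sqnorm y <= S ^+ 2.
  rewrite expr2 {2}/S mulr_sumr; apply: ler_sum => i _.
  rewrite -real_normK ?num_real// expr2 ler_wpM2r// /S (bigD1 i)//= lerDl.
  exact: sumr_ge0.
nra.
Qed.

Lemma measurable_MH_kernel d alpha (x : (d.-1).-tuple R) t : t != 0 ->
  measurable_fun setT (MH_kernel d alpha x t).
Proof.
move=> t0; rewrite /MH_kernel.
have mt i : measurable_fun [set: (d.-1).-tuple R] (fun y => tnth y i).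
  exact: measurable_tnth.
have msqrt (f : (d.-1).-tuple R -> R) : measurable_fun setT f ->
  measurable_fun setT (fun y => Num.sqrt (f y)).
  have ms : measurable_fun [set: R] (@Num.sqrt R).
    by apply: continuous_measurable_fun; exact: sqrt_continuous.
  by move=> mf; exact: measurableT_comp ms mf.
under eq_fun do rewrite -powRN.
apply: measurable_funM.
  apply: measurable_funM => //.
  apply: (measurableT_comp (measurable_powR _)); apply: msqrt.
  by apply: measurable_funD => //; apply: measurable_sum => i; exact: measurable_funX.
apply: (measurableT_comp (measurable_powR _)); apply: msqrt.
apply: measurable_funD => //; apply: measurable_sum => i; apply: measurable_funX.
exact: measurable_funB.
Qed.

Lemma sup_dist_ex {n} (x y : n.-tuple R) : exists rho : R, [/\ 0 <= rho,
  forall i, `|tnth x i - tnth y i| <= rho &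
  forall B, 0 <= B -> (forall i, `|tnth x i - tnth y i| <= B) -> rho <= B].
Proof.
exists (\big[Num.max/0]_(i < n) `|tnth x i - tnth y i|); split.
- exact: bigmax_ge_id.
- by move=> i; exact: le_bigmax.
- by move=> B B0 h; apply: bigmax_le => // i _; exact: h.
Qed.

(** The second variable enters the kernel only through the ratio [dist_ed y / distL x t y], so a
    bound [C] on that ratio is enough. *)
Lemma MH_kernel_le d alpha (x y : (d.-1).-tuple R) t C : 0 <= d%:R + alpha - 2 ->
  t != 0 -> dist_ed y <= C * distL x t y ->
  MH_kernel d alpha x t y <= `|t| `^ (alpha - 1) * C `^ (d%:R + alpha - 2).
Proof.
move=> p0 t0 hC; have d0 := distL_gt0 x y t t0; have e0 := dist_ed_gt0 y.
have C0 : 0 <= C.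
  by rewrite -(pmulr_lge0 _ d0) (le_trans _ hC)// ltW.
rewrite /MH_kernel -mulrA ler_wpM2l ?powR_ge0// ler_pdivrMr ?powR_gt0//.
rewrite -powRM ?(ltW d0)//; apply: ge0_ler_powR => //; rewrite nnegrE ?(ltW e0)//.
by rewrite mulr_ge0// ltW.
Qed.

(** The least k with rho <= 2^k t. By minimality 2^k t is not much larger than t or rho, hence is
    controlled by any [D] that dominates both up to a constant; [D] will be the distance in the
    denominator of the kernel. *)
Lemma dyadic_cover (rho t : R) : 0 < t -> 0 <= rho ->
  exists k, [/\ rho <= 2 ^+ k * t, 2 ^+ k * t <= Num.max t (2 * rho) &
     forall C, 1 <= C -> forall D, t <= D -> rho <= C * D -> 2 ^+ k * t <= 2 * C * D].
Proof.
move=> t0 r0.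
have ex : exists k, rho <= 2 ^+ k * t.
  exists (Num.truncn (rho / t)).+1; rewrite -ler_pdivrMr//.
  apply: (le_trans (ltW (truncnS_gt _))).
  by rewrite -natrX ler_nat ltnW// ltn_expl.
have [k hk kmin] := ex_minnP ex; exists k.
have [k0|k0] := posnP k.
  rewrite k0 expr0 mul1r; move: hk; rewrite k0 expr0 mul1r => rt; split => //.
    by rewrite le_max lexx.
  move=> C C1 D tD _; nra.
have k1 : 2 ^+ k.-1 * t < rho.
  by rewrite ltNge; apply/negP => /kmin; rewrite -ltnS prednK// ltnn.
have kE : 2 ^+ k * t = 2 * (2 ^+ k.-1 * t).
  by rewrite -[in LHS](prednK k0) exprS mulrA.
split => //; first by rewrite kE le_max ler_pM2l// (ltW k1) orbT.
by move=> C C1 D tD h; rewrite kE -mulrA ler_pM2l// (le_trans (ltW k1)).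
Qed.

End kernel.

(** * Nontangential vanishing at points of zero density *)

Section kernel_vanishing.
Context {R : realType}.

Lemma geometric_sum_le (q : R) N : 0 <= q < 1 ->
  \sum_(k < N) q ^+ k <= (1 - q)^-1.
Proof.
move=> /andP[q0 q1]; rewrite -[leRHS]mul1r ler_pdivlMr ?subr_gt0//.
rewrite -opprB mulrN mulrC -subrX1 opprB lerBlDr lerDl exprn_ge0//.
Qed.

(** Kernel bound on the k-th shell times the scale of the cube around it: the height [T] cancels and
    a geometric factor 2^(-s k) remains, which is why the shells can be summed uniformly in [T]. *)
Lemma dyadic_weight (n : nat) (s T C : R) (k : nat) : 0 < T -> 0 < C ->
  T `^ s * (C / (2 ^+ k * T)) `^ (n%:R + s) * (2 ^+ k.+1 * T) ^+ n =
  C `^ (n%:R + s) * 2 ^+ n * (2 `^ (- s)) ^+ k.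
Proof.
move=> T0 C0; set X := 2 ^+ k * T.
have X0 : 0 < X by rewrite mulr_gt0// exprn_gt0.
have -> : (C / X) `^ (n%:R + s) = C `^ (n%:R + s) / (X ^+ n * X `^ s).
  rewrite -powR_mulrn ?ltW// -powRD; last by rewrite (gt_eqF X0) implybT.
  have Xp : X `^ (n%:R + s) != 0 by rewrite gt_eqF// powR_gt0.
  by apply: (mulIf Xp); rewrite divfK// -powRM ?divr_ge0 ?ltW// divfK// gt_eqF.
have -> : (2 ^+ k.+1 * T) ^+ n = 2 ^+ n * X ^+ n.
  by rewrite exprS -mulrA exprMn.
have -> : X `^ s = (2 `^ s) ^+ k * T `^ s.
  by rewrite /X powRM ?exprn_ge0 ?ltW// -powR_mulrn// powRAC powR_mulrn// powR_ge0.
rewrite powRN exprVn.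
have h1 : T `^ s != 0 by rewrite gt_eqF// powR_gt0.
have h2 : X ^+ n != 0 by rewrite gt_eqF// exprn_gt0.
have h3 : (2 `^ s) ^+ k != 0 by rewrite gt_eqF// exprn_gt0// powR_gt0.
by field; rewrite h1 h2 h3.
Qed.

(** Away from [y0] the kernel is O(T^s), with T = |t| and s = alpha - 1. Close to [y0], the cone
    condition makes |x-y| at least comparable to 2^k T on the shell at distance about 2^k T from
    [y0]; zero density bounds the mass of each shell, and the resulting series is geometric. *)
Lemma MH_kernel_vanish d alpha
    (sigma : {finite_measure set ((d.-1).-tuple R) -> \bar R})
    (y0 : (d.-1).-tuple R) :
  (2 <= d)%N -> 1 < alpha -> zero_density sigma y0 ->
  forall beta : R, 0 < beta -> forall eps : R, 0 < eps ->
  exists2 delta : R, 0 < delta & forall (x : (d.-1).-tuple R) (t : R), t != 0 ->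
    distL x t y0 < (1 + beta) * `|t| -> distL x t y0 < delta ->
    (\int[sigma]_y (MH_kernel d alpha x t y)%:E <= eps%:E)%E.
Proof.
move=> d2 a1 zd beta b0 eps eps0.
pose n := d.-1; pose s := alpha - 1; pose p := d%:R + alpha - 2.
have s0 : 0 < s by rewrite subr_gt0.
have pE : p = n%:R + s.
  by rewrite /p /s /n -[in LHS](prednK (ltnW d2)) -natr1; ring.
have p0 : 0 <= p by rewrite pE addr_ge0// ltW.
pose q : R := 2 `^ (- s).
have q01 : 0 <= q < 1.
  rewrite powR_ge0/= /q powRN invf_lt1 ?powR_gt0//.
  apply: (@le_lt_trans _ _ (1 `^ s)); first by rewrite powR1.
  by apply: gt0_ltr_powR; rewrite ?nnegrE// ltr1n.
pose S0 : R := 1 + \sum_(i < n) `|tnth y0 i|.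
have S01 : 1 <= S0 by rewrite lerDl sumr_ge0.
have dist_ed_bound y rho : 0 <= rho -> (forall i, `|tnth y i - tnth y0 i| <= rho) ->
    dist_ed y <= S0 + n%:R * rho.
  move=> r0 h; apply: (le_trans (dist_ed_le y)); rewrite /S0 -addrA lerD2l.
  have -> : n%:R * rho = \sum_(i < n) rho by rewrite sumr_const card_ord mulr_natl.
  rewrite -big_split/=; apply: ler_sum => i _.
  have := ler_normD (tnth y0 i) (tnth y i - tnth y0 i).
  by rewrite (addrC _ (_ - _)) subrK => /le_trans; apply; rewrite lerD2l.
(* For rho <= 1, [dist_ed y] is at most S0 + n. In the cone rho <= (2 + beta) |x-y|, so
   [dyadic_cover] gives 2^k T <= 2 (2 + beta) |x-y|. *)
pose C : R := (S0 + n%:R) * (2 * (2 + beta)).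
have Sn0 : 0 < S0 + n%:R by rewrite ltr_wpDr// (lt_le_trans _ S01).
have C0 : 0 < C by rewrite mulr_gt0// mulr_gt0// addr_gt0.
(* Chosen so that the sum of the geometric series over all shells is eps/2. *)
pose e1 : R := eps / 2 * (1 - q) / (C `^ p * 2 ^+ n).
have e10 : 0 < e1.
  case/andP: q01 => _ q1.
  by rewrite divr_gt0 ?mulr_gt0 ?invr_gt0 ?powR_gt0 ?exprn_gt0 ?subr_gt0.
have [r0 r00 hr0] := zd e1 e10.
(* With rho < r1 and T < r1/2, the doubled half-side 2^(k+1) T stays below r0; the bound 1 serves
   the estimate of [dist_ed]. *)
pose r1 := Num.min (r0 / 8) 1.
have r10 : 0 < r1 by rewrite lt_min divr_gt0/=.
have r18 : r1 <= r0 / 8 by rewrite ge_min lexx.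
have r11 : r1 <= 1 by rewrite ge_min lexx orbT.
(* A local constant that shadows the normalizing one: for rho >= r1, S0 + n rho <= C3 rho, and rho
   <= 2 |x-y|. *)
pose C3 : R := S0 / r1 + n%:R.
pose C1 : R := (2 * C3) `^ p.
pose M0 := fine (sigma setT).
have M0E : sigma setT = M0%:E by rewrite fineK// fin_num_measure.
have M00 : 0 <= M0 by rewrite fine_ge0.
have CM0 : 0 < C1 * M0 + 1 by rewrite ltr_wpDl// mulr_ge0// powR_ge0.
(* The added 1 keeps the denominator positive when [sigma] has mass zero; delta <= eta^(1/s) then
   forces T^s <= eta. *)
pose eta := eps / 2 / (C1 * M0 + 1).
have eta0 : 0 < eta by rewrite !divr_gt0.
pose delta := Num.min (r1 / 2) (eta `^ s^-1).
have delta0 : 0 < delta by rewrite lt_min divr_gt0//= powR_gt0.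
exists delta => // x t t0 hbeta hdelta.
pose T := `|t|.
have T0 : 0 < T by rewrite normr_gt0.
have Tdelta : T < delta by apply: le_lt_trans hdelta; exact: ler_distL_height.
have [dr1 deta] : delta <= r1 / 2 /\ delta <= eta `^ s^-1.
  by split; rewrite ge_min lexx ?orbT.
have Teta : T `^ s <= eta.
  have -> : eta = (eta `^ s^-1) `^ s by rewrite -powRrM mulVf ?gt_eqF// powRr1// ltW.
  apply: ge0_ler_powR; rewrite ?nnegrE ?powR_ge0 ?(ltW T0) ?(ltW s0)//.
  exact: le_trans (ltW Tdelta) deta.
pose P (k : nat) := 2 ^+ k.+1 * T < r0.
(* Only shells whose cube is small enough for the density bound get a nonzero weight; since 2^(k+1)
   > k, they all have k < r0/T, hence index below [N]. *)
pose a k := if P k then T `^ s * (C / (2 ^+ k * T)) `^ p else 0.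
have a0 k : 0 <= a k by rewrite /a; case: ifP => // _; rewrite mulr_ge0// powR_ge0.
pose N := (Num.truncn (r0 / T)).+1.
(* Doubling the half-side turns rho <= 2^k T into the strict inequality that the open side of the
   cube requires. *)
pose Q k := cube y0 (2 ^+ k.+1 * T).
have bound y : MH_kernel d alpha x t y <=
    T `^ s * C1 + \sum_(k < N) a k * \1_(Q k) y.
  have sum0 : 0 <= \sum_(k < N) a k * \1_(Q k) y.
    by rewrite sumr_ge0// => k _; rewrite mulr_ge0.
  have [rho [rho0 hrho rhomin]] := sup_dist_ex y y0.
  have rho_le : rho <= distL x t y + distL x t y0.
    apply: rhomin; first by rewrite addr_ge0// ltW// distL_gt0.
    move=> i; rewrite (le_trans (ler_distD (tnth x i) _ _))// lerD ?ler_distL//.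
    by rewrite distrC ler_distL.
  have [far|near] := leP r1 rho.
    apply: (@le_trans _ _ (T `^ s * C1)); last by rewrite lerDl.
    apply: MH_kernel_le => //.
    apply: (le_trans (dist_ed_bound _ _ rho0 hrho)).
    have rho2 : rho <= 2 * distL x t y by move: far rho_le hdelta dr1; clear; lra.
    have C30 : 0 <= C3 by rewrite addr_ge0// divr_ge0 ?(ltW r10)// (le_trans _ S01).
    apply: (@le_trans _ _ (C3 * rho)).
      rewrite /C3 mulrDl lerD2r -mulrA ler_peMr ?(le_trans _ S01)//.
      by rewrite mulrC ler_pdivlMr// mul1r.
    by rewrite (mulrC 2) -mulrA ler_wpM2l.
  have [k [hk kmax kdist]] := dyadic_cover rho T T0 rho0.
  have Pk : P k.
    rewrite /P exprS -mulrA; have Tr1 := lt_le_trans Tdelta dr1.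
    by move: kmax; rewrite le_max => /orP[]; move: near r18 r10 Tr1; clear; lra.
  have kN : (k < N)%N.
    rewrite -(ltr_nat R) (lt_trans _ (truncnS_gt _))// ltr_pdivlMr//.
    apply: le_lt_trans Pk; rewrite ler_pM2r// -natrX ler_nat.
    by rewrite ltnW// (ltn_trans (ltnSn _))// ltn_expl.
  have Qy : Q k y.
    move=> i; have := hrho i; rewrite ler_norml => /andP[h1 h2].
    have : 0 < 2 ^+ k * T by rewrite mulr_gt0// exprn_gt0.
    by rewrite exprS -mulrA; move: h1 h2 hk; clear; lra.
  apply: (@le_trans _ _ (a k)); last first.
    rewrite (bigD1 (Ordinal kN))//= indicE mem_set// mulr1 addrCA lerDl.
    by rewrite addr_ge0 ?mulr_ge0 ?powR_ge0// sumr_ge0// => j _; rewrite mulr_ge0.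
  rewrite /a Pk; apply: MH_kernel_le => //.
  have X0 : 0 < 2 ^+ k * T by rewrite mulr_gt0// exprn_gt0.
  rewrite mulrAC ler_pdivlMr//.
  have h := kdist (2 + beta) _ (distL x t y) (ler_distL_height _ _ _) _.
  have {}h : 2 ^+ k * T <= 2 * (2 + beta) * distL x t y.
    apply: h; first by move: b0; clear; lra.
    have := ler_distL_height x y t; rewrite -/T => hT.
    have b1 : 0 <= 1 + beta by rewrite addr_ge0// ltW.
    rewrite -/T in hbeta; have := ler_wpM2l b1 hT; move: rho_le hbeta; clear; lra.
  rewrite /C -mulrA ler_pM ?dist_ed_ge0 ?(ltW X0)//.
  apply: (le_trans (dist_ed_bound _ _ rho0 hrho)); rewrite lerD2l.
  by rewrite ler_piMr// (le_trans (ltW near)).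
have mQ k : measurable (Q k) by exact: measurable_cube.
have mQf k : measurable_fun setT (fun y => ((a k)%:E * (\1_(Q k) y)%:E)%E).
  by apply: emeasurable_funM => //; apply/measurable_EFinP; exact: measurable_indic.
apply: (@le_trans _ _ (\int[sigma]_y ((T `^ s * C1)%:E +
    \sum_(k < N) (a k)%:E * (\1_(Q k) y)%:E))%E).
  apply: ge0_le_integral => //.
  - by move=> y _; rewrite lee_fin !mulr_ge0 ?invr_ge0 ?powR_ge0.
  - by apply/measurable_EFinP; exact: measurable_MH_kernel.
  - apply: emeasurable_funD => //; exact: emeasurable_sum.
  - move=> y _; under eq_bigr do rewrite -EFinM.
    by rewrite sumEFin -EFinD lee_fin bound.
rewrite ge0_integralD//; last 3 first.
- by move=> y _; rewrite lee_fin mulr_ge0// powR_ge0.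
- by move=> y _; rewrite sume_ge0// => k _; rewrite mule_ge0// lee_fin.
- exact: emeasurable_sum.
rewrite integral_cst// [X in (_ * X + _)%E](_ : _ = M0%:E)// -EFinM.
rewrite ge0_integral_sum//; last by move=> k y _; rewrite mule_ge0// lee_fin.
rewrite [eps]splitr EFinD leeD//.
  rewrite lee_fin -mulrA (le_trans (ler_wpM2r _ Teta)) ?mulr_ge0 ?powR_ge0//.
  by rewrite /eta mulrAC ler_pdivrMr// ler_wpM2l ?divr_ge0 ?ltW// ltrDl.
apply: (@le_trans _ _ (\sum_(k < N) (C `^ p * 2 ^+ n * q ^+ k * e1)%:E)%E).
  apply: lee_sum => k _; rewrite ge0_integralZl//; last 2 first.
  - by apply/measurable_EFinP; exact: measurable_indic.
  - by rewrite lee_fin.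
  rewrite integral_indic// setIT.
  have X0 : 0 < 2 ^+ k.+1 * T by rewrite mulr_gt0// exprn_gt0.
  rewrite /a; case: ifPn => Pk; last first.
    have q0 : 0 <= q by case/andP: q01.
    rewrite mul0e lee_fin mulr_ge0 ?(ltW e10)//.
    by rewrite mulr_ge0 ?exprn_ge0// mulr_ge0 ?exprn_ge0 ?powR_ge0.
  have hc : (sigma (Q k) <= (e1 * (2 ^+ k.+1 * T) ^+ n)%:E)%E.
    apply: hr0; first by rewrite X0.
    by move=> i; move: X0; clear; lra.
  apply: (le_trans (lee_wpmul2l _ hc)); first by rewrite lee_fin mulr_ge0// powR_ge0.
  by rewrite -EFinM lee_fin mulrCA mulrC pE dyadic_weight.
rewrite sumEFin lee_fin -mulr_suml -mulr_sumr.
have := geometric_sum_le q N q01.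
have q1 : 0 < 1 - q by case/andP: q01; rewrite subr_gt0.
set G := \sum_(k < N) _ => hG.
have Cn0 : 0 < C `^ p * 2 ^+ n by rewrite mulr_gt0 ?powR_gt0// exprn_gt0.
rewrite mulrAC [X in X * G](_ : _ = eps / 2 * (1 - q)); last first.
  by rewrite /e1 mulrC divfK// gt_eqF.
have eps20 : 0 <= eps / 2 by rewrite divr_ge0// ltW.
by rewrite -mulrA ler_piMr// mulrC -ler_pdivlMr// mul1r.
Qed.

End kernel_vanishing.

(** * Integration against densities and Lebesgue measure *)

Section density.
Context {dd} {T : measurableType dd} {R : realType}.
Variables (m : {measure set T -> \bar R}) (w : T -> R).
Hypotheses (mw : measurable_fun setT w) (w0 : forall x, 0 <= w x).

(** The proofs are arguments so that the measure structure can be attached to the term itself. *)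
Definition density_measure of measurable_fun setT w & (forall x, 0 <= w x) :
  set T -> \bar R := fun A => (\int[m]_(x in A) (w x)%:E)%E.

Local Notation nu := (density_measure mw w0).

Let nu0 : nu set0 = 0%E.
Proof. exact: integral_set0. Qed.

Let nu_ge0 A : (0 <= nu A)%E.
Proof. by apply: integral_ge0 => x _; rewrite lee_fin. Qed.

Let nu_sigma_additive : semi_sigma_additive nu.
Proof.
apply: semi_sigma_additive_nng_induced; first exact/measurable_EFinP.
by move=> x; rewrite lee_fin.
Qed.

HB.instance Definition _ := isMeasure.Build _ _ _ nu nu0 nu_ge0 nu_sigma_additive.

Import HBNNSimple.

(** By monotone convergence on both sides it reduces to indicators. [om] is any measure with density
    [w], so this covers [omega] as well as [density_measure]. *)
Lemma integral_density (om : {measure set T -> \bar R}) (f : T -> \bar R) :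
  (forall A, measurable A -> om A = (\int[m]_(x in A) (w x)%:E)%E) ->
  measurable_fun setT f -> (forall x, (0 <= f x)%E) ->
  (\int[om]_x f x = \int[m]_x (f x * (w x)%:E))%E.
Proof.
move=> omE mf f0; pose h := nnsfun_approx measurableT mf.
have mwE : measurable_fun setT (EFin \o w) by exact/measurable_EFinP.
have -> : (\int[om]_x f x = lim (\int[om]_x (EFin \o h n) x @[n --> \oo]))%E.
  have fE x : f x = lim ((EFin \o h n) x @[n --> \oo]).
    by apply/esym/cvg_lim => //; exact: cvg_nnsfun_approx.
  under eq_integral do rewrite fE.
  apply: monotone_convergence => //.
  - by move=> n; exact/measurable_EFinP.
  - by move=> n x _; rewrite lee_fin.
  - by move=> x _ a b ab; rewrite lee_fin; exact/lefP/nd_nnsfun_approx.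
have -> : (\int[m]_x (f x * (w x)%:E) =
    lim (\int[m]_x ((EFin \o h n) x * (w x)%:E) @[n --> \oo]))%E.
  have fE x : (f x * (w x)%:E = lim (((EFin \o h n) x * (w x)%:E) @[n --> \oo]))%E.
    by apply/esym/cvg_lim => //; apply: cvgeZr => //; exact: cvg_nnsfun_approx.
  under eq_integral do rewrite fE.
  apply: monotone_convergence => //.
  - by move=> n; apply: emeasurable_funM => //; exact/measurable_EFinP.
  - by move=> n x _; rewrite mule_ge0 ?lee_fin.
  - move=> x _ a b ab; rewrite lee_wpmul2r ?lee_fin//.
    exact/lefP/nd_nnsfun_approx.
congr (limn _); apply/funext => n.
have mind r : measurable_fun setT (fun x => (\1_(h n @^-1` [set r]) x)%:E : \bar R).
  by apply/measurable_EFinP; exact: measurable_indic.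
transitivity (\int[om]_x (\sum_(y \in range (h n))
    (y * \1_(h n @^-1` [set y]) x)%:E))%E.
  by apply: eq_integral => t _; rewrite /= fimfunE -fsumEFin.
rewrite ge0_integral_fsum//; last 2 first.
- by move=> r; under eq_fun do rewrite EFinM; exact: emeasurable_funM.
- by move=> r y _; exact: nnfun_muleindic_ge0.
transitivity (\int[m]_x (\sum_(y \in range (h n))
    (y * \1_(h n @^-1` [set y]) x)%:E * (w x)%:E))%E; last first.
  apply: eq_integral => x _; rewrite -ge0_mule_fsuml.
    by rewrite fsumEFin// -fimfunE.
  by move=> y; exact: nnfun_muleindic_ge0.
rewrite ge0_integral_fsum//; last 2 first.
- move=> r; under eq_fun do rewrite EFinM.
  by apply: emeasurable_funM => //; exact: emeasurable_funM.
- by move=> r y _; apply: mule_ge0; [exact: nnfun_muleindic_ge0|rewrite lee_fin].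
apply: eq_fsbigr => r; rewrite inE => -[t _ <-].
under eq_integral do rewrite EFinM.
under [RHS]eq_integral do rewrite EFinM -muleA.
have h0 : 0 <= h n t by [].
rewrite !ge0_integralZl//; last 2 first.
- exact: emeasurable_funM.
- by move=> y _; rewrite mule_ge0// lee_fin.
congr (_ * _)%E; rewrite integral_indic// setIT omE//.
under [RHS]eq_integral do rewrite muleC.
rewrite integral_mkcond; apply: eq_integral => x _.
by rewrite epatch_indic.
Qed.

End density.

Section marginal.
Context {dd} {T : measurableType dd} {R : realType}.

(** The image of [nu] under [phi], divided by [D], agrees with Lebesgue measure on half-open
    intervals, hence equals it. It serves both for a coordinate of R^n and for the scaling of the
    line. *)
Lemma integral_comp_lebesgue (nu : {measure set T -> \bar R}) (phi : T -> R) (D : R)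
    (f : R -> \bar R) :
  measurable_fun setT phi -> 0 < D ->
  (forall a b, a < b -> nu (phi @^-1` `]a, b]%classic) = (D * (b - a))%:E) ->
  measurable_fun setT f -> (forall x, (0 <= f x)%E) ->
  (\int[nu]_y f (phi y) = D%:E * \int[@lebesgue_measure R]_x f x)%E.
Proof.
move=> mphi D0 nuE mf f0.
have mphi' : measurable_fun setT (phi : T -> measurableTypeR R) by [].
have Di0 : 0 <= D^-1 by rewrite invr_ge0 ltW.
pose P : {measure set (measurableTypeR R) -> \bar R} :=
  pushforward nu (phi : T -> measurableTypeR R).
pose M : {measure set (measurableTypeR R) -> \bar R} := mscale (NngNum Di0) (P mphi').
have ME A : measurable A -> lebesgue_measure A = M A.
  apply: lebesgue_measure_unique => _ [[a b] _ <-] /=.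
  rewrite /M/= /mscale/= /P/= /pushforward/=.
  have [ba|ab] := leP b a.
    by rewrite set_itv_ge ?bnd_simp -?leNgt// preimage_set0 !measure0 mule0.
  rewrite lebesgue_measure_itv/= lte_fin ab nuE// -EFinM mulrA mulVf ?gt_eqF//.
  by rewrite mul1r.
have <- : (\int[M]_x f x = \int[@lebesgue_measure R]_x f x)%E.
  by apply: eq_measure_integral => A mA _; rewrite -ME.
rewrite /M ge0_integral_mscale//= muleA -EFinM mulfV ?gt_eqF// mul1e.
by rewrite /P [RHS]ge0_integral_pushforward// preimage_setT.
Qed.

End marginal.

(** * Integrals of products over R^n *)

Section product_integral.
Context {R : realType} {n : nat}.
Local Notation V := (n.-tuple R).
Local Notation lambda := (@lebesgue_measure R).

(** Strict positivity of [c] is included because the k-th marginal is normalized by dividing by the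
    product of the other integrals. *)
Definition has_integral (g : R -> R) (c : R) := [/\ measurable_fun setT g,
  forall x, 0 <= g x, 0 < c & (\int[lambda]_x (g x)%:E = c%:E)%E].

Lemma has_integral_itv (a b : R) : a < b -> has_integral \1_(`]a, b]%classic) (b - a).
Proof.
move=> ab; split => //; first by rewrite subr_gt0.
by rewrite integral_indic//= setIT lebesgue_measure_itv/= lte_fin ab.
Qed.

Variable leb : {measure set V -> \bar R}.
Hypothesis Hleb : is_lebesgue_measure leb.

Let measurable_prod_tnth (P : pred 'I_n) (h : 'I_n -> R -> R) :
  (forall i, measurable_fun setT (h i)) ->
  measurable_fun setT (fun y : V => \prod_(i < n | P i) h i (tnth y i)).
Proof.
move=> mh; under eq_fun do rewrite big_mkcond/=.
apply: measurable_prod => i _; case: (P i) => //.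
by apply: (measurableT_comp (mh i)); exact: measurable_tnth.
Qed.

(* Coordinate [k] is upgraded from intervals to arbitrary functions: with the other
   factors fixed, the k-th marginal agrees with Lebesgue measure on intervals,
   hence on all Borel sets. *)
Lemma integral_prod_partial k (h : 'I_n -> R -> R) (m : 'I_n -> R) :
  (forall i, has_integral (h i) (m i)) ->
  (forall i : 'I_n, (k <= i)%N -> exists a b, a < b /\ h i = \1_(`]a, b]%classic)) ->
  (\int[leb]_y (\prod_(i < n) h i (tnth y i))%:E = (\prod_(i < n) m i)%:E)%E.
Proof.
elim: k h m => [|k IH] h m hm hab.
  have /choice[a ha] i : exists a, exists b, a < b /\ h i = \1_(`]a, b]%classic).
    exact: hab.
  have /choice[b hb] i : exists b, a i < b /\ h i = \1_(`](a i), b]%classic) := ha i.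
  have mE i : m i = b i - a i.
    have [_ _ _] := hm i; have [abi ->] := hb i.
    by have [_ _ _ ->] := has_integral_itv _ _ abi => -[].
  have := Hleb [tuple a i | i < n] [tuple b i | i < n].
  under eq_bigr do rewrite !tnth_mktuple -mE.
  move=> <-; last by move=> i; rewrite !tnth_mktuple; have [/ltW] := hb i.
  set B := (X in leb X).
  have mB : measurable B.
    have -> : B = \big[setI/setT]_(i < n)
        ((fun x : V => tnth x i) @^-1` `]a i, b i]%classic).
      rewrite -bigcap_seq; apply/seteqP; split => x hx i.
        by move=> _ /=; rewrite in_itv/=; have := hx i; rewrite !tnth_mktuple.
      by have := hx i (mem_index_enum i); rewrite /= in_itv/= !tnth_mktuple.
    apply: big_ind => //; first exact: measurableI.
    move=> i _; rewrite -[X in measurable X]setTI; exact: measurable_tnth.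
  rewrite -[B in RHS]setIT -integral_indic//; apply: eq_integral => y _; congr EFin.
  rewrite indicE; have [|nBy] := boolP (y \in B).
    rewrite inE => By; rewrite big1// => i _; have [_ ->] := hb i.
    by rewrite indicE mem_set//=; have := By i; rewrite !tnth_mktuple in_itv.
  apply/eqP; rewrite prodf_seq_eq0; apply/hasP.
  have [i hi] : exists i : 'I_n, ~ (a i < tnth y i <= b i).
    apply/existsNP => hy; move/negP: nBy; apply; rewrite inE => i.
    by rewrite !tnth_mktuple.
  exists i; first exact: mem_index_enum.
  by have [_ ->] := hb i; rewrite /= indicE memNset//= in_itv.
have [nk|kn] := leqP n k.
  apply: IH => // i ki; exfalso.
  by have := leq_trans nk ki; rewrite leqNgt ltn_ord.
pose K := Ordinal kn.
pose w (y : V) := \prod_(i < n | i != K) h i (tnth y i).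
pose D := \prod_(i < n | i != K) m i.
have mh i : measurable_fun setT (h i) by have [] := hm i.
have h0 i x : 0 <= h i x by have [_ + _ _] := hm i; apply.
have D0 : 0 < D by apply: prodr_gt0 => i _; have [] := hm i.
have mw : measurable_fun setT w by exact: measurable_prod_tnth.
have w0 y : 0 <= w y by exact: prodr_ge0.
pose nu := density_measure leb w mw w0.
have mK : measurable_fun setT (fun y : V => tnth y K) by exact: measurable_tnth.
have nuE f : measurable_fun setT f -> (forall x, (0 <= f x)%E) ->
    (\int[nu]_y f (tnth y K) = \int[leb]_y (f (tnth y K) * (w y)%:E))%E.
  by move=> mf f0; apply: integral_density => //; exact: measurableT_comp.
have ME a b : a < b ->
    nu ((fun y : V => tnth y K) @^-1` `]a, b]%classic) = (D * (b - a))%:E.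
  move=> ab.
  have -> : nu ((fun y : V => tnth y K) @^-1` `]a, b]%classic) =
     (\int[leb]_y ((\1_(`]a, b]%classic) (tnth y K))%:E * (w y)%:E))%E.
    rewrite /nu /density_measure integral_mkcond; apply: eq_integral => y _.
    by rewrite epatch_indic muleC; congr (_%:E * _)%E; rewrite !indicE.
  (* With an interval indicator in position [K], only the first k factors are general, so the
     induction hypothesis computes the marginal on ]a, b]. *)
  pose h' i := if i == K then \1_(`]a, b]%classic) else h i.
  pose m' i := if i == K then b - a else m i.
  have -> : (\int[leb]_x ((\1_(`]a, b]%classic) (tnth x K))%:E * (w x)%:E) =
      \int[leb]_x (\prod_(i < n) h' i (tnth x i))%:E)%E.
    apply: eq_integral => y _; rewrite -EFinM (bigD1 K)//= /h' eqxx; congr (_ * _)%:E.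
    by apply: eq_bigr => i /negbTE ->.
  rewrite (IH h' m').
  - rewrite (bigD1 K)//= /m' eqxx (eq_bigr m); last by move=> i /negbTE ->.
    by rewrite -/D mulrC.
  - by move=> i; rewrite /h' /m'; case: ifP => // _; exact: has_integral_itv.
  - move=> i ki; rewrite /h'; case: ifPn => [_|iK]; first by exists a, b.
    by apply: hab; rewrite ltn_neqAle ki andbT eq_sym.
have [_ _ _ hKE] := hm K.
transitivity (\int[leb]_y ((h K (tnth y K))%:E * (w y)%:E))%E.
  by apply: eq_integral => y _; rewrite -EFinM (bigD1 K).
rewrite -(nuE (fun x => (h K x)%:E)); last 2 first.
- exact/measurable_EFinP.
- by move=> x; rewrite lee_fin.
rewrite (bigD1 K)//= -/D mulrC EFinM -hKE.
apply: integral_comp_lebesgue => //; first exact/measurable_EFinP.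
by move=> x; rewrite lee_fin.
Qed.

Lemma integral_prod_tnth (h : 'I_n -> R -> R) (m : 'I_n -> R) :
  (forall i, has_integral (h i) (m i)) ->
  (\int[leb]_y (\prod_(i < n) h i (tnth y i))%:E = (\prod_(i < n) m i)%:E)%E.
Proof.
move=> hm; apply: (integral_prod_partial n) => // i.
by rewrite leqNgt ltn_ord.
Qed.

End product_integral.

(** * Gaussian and Gamma integrals *)

Section gauss_gamma.
Context {R : realType}.
Local Notation lambda := (@lebesgue_measure R).

Lemma has_integral_gauss (u x : R) : 0 < u ->
  has_integral (fun y => expR (- (u * (x - y) ^+ 2))) (Num.sqrt (pi / u)).
Proof.
move=> u0; have piu : 0 < pi / u by rewrite divr_gt0// pi_gt0.
have mg : measurable_fun [set: R] (fun y => expR (- (u * (x - y) ^+ 2))).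
  apply: measurableT_comp => //; apply: measurable_funN.
  apply: measurable_funM => //; apply: measurable_funX; exact: measurable_funB.
have mgE : measurable_fun [set: R] (fun y => (expR (- (u * (x - y) ^+ 2)))%:E).
  exact/measurable_EFinP.
split=> //.

- by rewrite sqrtr_gt0.
(* The Gaussian is a multiple of the normal density of mean [x] and variance 1/(2u), whose total
   mass is 1. *)
pose sg := Num.sqrt ((2 * u)^-1).
have sg2 : sg ^+ 2 = (2 * u)^-1 by rewrite sqr_sqrtr// invr_ge0 mulr_ge0// ltW.
have sg0 : sg != 0 by rewrite gt_eqF// sqrtr_gt0 invr_gt0 mulr_gt0.
have peakE : normal_peak sg = (Num.sqrt (pi / u))^-1.
  rewrite /normal_peak sg2; congr (Num.sqrt _)^-1.
  by rewrite -mulr_natr; field; rewrite gt_eqF.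
have := integral_normal_pdf x sg.
rewrite normal_pdfE//; under eq_integral do rewrite EFinM.
have -> : normal_fun x sg = (fun y => expR (- (u * (x - y) ^+ 2))).
  apply/funext => y; rewrite /normal_fun; congr expR.
  by rewrite sg2 -mulr_natr; field; rewrite gt_eqF.
rewrite ge0_integralZl//; last first.
  by rewrite lee_fin normal_peak_ge0.
rewrite peakE => /(congr1 (mule (Num.sqrt (pi / u))%:E)).
by rewrite muleA -EFinM mulfV ?mul1e ?mule1// gt_eqF// sqrtr_gt0.
Qed.

Definition gamma_integral (a : R) : \bar R :=
  (\int[lambda]_(t in `]0%R, +oo[) (t `^ (a - 1) * expR (- t))%:E)%E.

Lemma measurable_gamma_integrand (a c : R) D :
  measurable_fun D (fun t : R => (t `^ (a - 1) * expR (- (c * t)))%:E).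
Proof.
apply: measurable_funTS; apply/measurable_EFinP; apply: measurable_funM.
  exact: measurable_powR.
apply: measurableT_comp => //; apply: measurable_funN; exact: measurable_funM.
Qed.

Lemma measurable_gamma_integrand1 (a : R) D :
  measurable_fun D (fun t : R => (t `^ (a - 1) * expR (- t))%:E).
Proof.
have := measurable_gamma_integrand a 1 D; congr measurable_fun.
by apply/funext => t; rewrite mul1r.
Qed.

Lemma gamma_integral_scale (a c : R) : 0 < c ->
  (\int[lambda]_(t in `]0%R, +oo[) (t `^ (a - 1) * expR (- (c * t)))%:E =
   (c `^ (- a))%:E * gamma_integral a)%E.
Proof.
move=> c0.
pose g (t : R) : \bar R := (t `^ (a - 1) * expR (- (1 * t)))%:E.
pose f := g \_ `]0, +oo[%classic.
have mf : measurable_fun setT f.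
  by apply/(measurable_restrictT _ _).1 => //; exact: measurable_gamma_integrand.
have f0 x : (0 <= f x)%E.
  by apply: erestrict_ge0 => y _; rewrite lee_fin mulr_ge0 ?powR_ge0 ?expR_ge0.
have := @integral_comp_lebesgue _ _ R lambda (fun t => c * t) c^-1 f.
have -> // : (\int[lambda]_x f x)%E = gamma_integral a.
  rewrite /f -integral_mkcond; apply: eq_integral => t _.
  by rewrite /g mul1r.
move=> /(_ _ _ _ mf f0) => H.
have {}H : (\int[lambda]_y f (c * y)%R = (c^-1)%:E * gamma_integral a)%E.
  apply: H; [exact: measurable_funM|by rewrite invr_gt0|].
  move=> x y xy.
  rewrite (_ : _ @^-1` _ = `]c^-1 * x, c^-1 * y]%classic).
    rewrite /= lebesgue_measure_itv/= lte_fin ltr_pM2l ?invr_gt0// xy.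
    by rewrite -EFinB -mulrBr.
  apply/seteqP; split => z /=; rewrite !in_itv/= ![c^-1 * _]mulrC;
  by rewrite ltr_pdivrMr// ler_pdivlMr// mulrC.
pose h (t : R) : \bar R := (t `^ (a - 1) * expR (- (c * t)))%:E.
have mh : measurable_fun setT (h \_ `]0, +oo[%classic).
  by apply/(measurable_restrictT _ _).1 => //; exact: measurable_gamma_integrand.
have fE y : f (c * y) = ((c `^ (a - 1))%:E * (h \_ `]0%R, +oo[%classic) y)%E.
  rewrite /f !patchE !mem_setE !in_itv/= !andbT pmulr_rgt0//.
  case: ifPn => [y0|]; last by rewrite mule0.
  by rewrite /g /h -EFinM mul1r powRM ?ltW// mulrA.
rewrite integral_mkcond -/h.
have ca0 : 0 < c `^ (a - 1) by rewrite powR_gt0.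
have : ((c `^ (a - 1))%:E * \int[lambda]_x (h \_ `]0%R, +oo[%classic) x =
   (c^-1)%:E * gamma_integral a)%E.
  rewrite -H -ge0_integralZl//; first by apply: eq_integral => y _; rewrite fE.
  - by move=> x _; apply: erestrict_ge0 => y _; rewrite lee_fin mulr_ge0 ?powR_ge0 ?expR_ge0.
  - by rewrite lee_fin ltW.
move/(congr1 (mule ((c `^ (a - 1))^-1)%:E)).
rewrite muleA -EFinM mulVf ?gt_eqF// mul1e => ->.
rewrite muleA -EFinM; congr (_%:E * _)%E.
rewrite -powRN -(powR_inv1 (ltW c0)) -powRD; last by rewrite (gt_eqF c0) implybT.
by congr (_ `^ _); ring.
Qed.

(** On ]1, 2] the integrand is at least exp(-2)/2, since t^(a-1) >= 1/t there. *)
Lemma gamma_integral_gt0 (a : R) : 0 < a -> (0 < gamma_integral a)%E.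
Proof.
move=> a0.
have h : ((2^-1 * expR (- 2))%:E <= gamma_integral a)%E.
  have -> : ((2^-1 * expR (- 2))%:E =
      \int[lambda]_(t in `]1%R, 2%R]) (2^-1 * expR (- 2))%:E)%E.
    rewrite integral_cst//= lebesgue_measure_itv/= lte_fin ltr1n.
    by rewrite -EFinB -EFinM [2 - 1](_ : _ = 1) ?mulr1//; ring.
  apply: (@le_trans _ _ (\int[lambda]_(t in `]1%R, 2%R]) (t `^ (a - 1) * expR (- t))%:E)%E).
    apply: ge0_le_integral => //.
    - exact: measurable_gamma_integrand1.
    - move=> t /=; rewrite in_itv/= => /andP[t1 t2]; rewrite lee_fin ler_pM ?expR_ge0//.
        apply: (@le_trans _ _ (t `^ (- 1))).
          have t0 : 0 < t by rewrite (lt_trans _ t1).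
          by rewrite powR_inv1 ?(ltW t0)// lef_pV2// posrE.
        by apply: ler_powR; [exact: ltW|move: a0; clear; lra].
      by rewrite ler_expR lerN2.
  apply: ge0_subset_integral => //.
  - exact: measurable_gamma_integrand1.
  - by move=> t _; rewrite lee_fin mulr_ge0 ?powR_ge0 ?expR_ge0.
  - move=> t /=; rewrite !in_itv/= andbT => /andP[t1 _]; exact: lt_trans t1.
by apply: lt_le_trans h; rewrite lte_fin mulr_gt0// ?invr_gt0 ?expR_gt0.
Qed.

End gauss_gamma.

(** * Finiteness of the Gamma integral *)

Section gamma_finite.
Context {R : realType}.
Local Notation lambda := (@lebesgue_measure R).

Lemma integral_powR_le1 (a : R) : 0 < a ->
  (\int[lambda]_(t in `]0%R, 1%R]) (a * t `^ (a - 1))%:E <= 1)%E.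
Proof.
(* The integrand may be singular at 0, so the antiderivative t^a is used on intervals away from 0,
   followed by a monotone limit. Starting at 1/2 keeps every interval nondegenerate. *)
move=> a0; pose F (k : nat) : set R := `[k.+2%:R^-1, 1]%classic.
have FE : `]0, 1]%classic = \bigcup_k F k.
  apply/seteqP; split=> t /=.
    rewrite in_itv/= => /andP[t0 t1]; exists (Num.truncn t^-1) => //=.
    rewrite /F/= in_itv/= t1 andbT invf_ple ?posrE// ltW//.
    by rewrite (lt_trans (truncnS_gt _))// ltr_nat.
  by move=> [k _]; rewrite /F/= !in_itv/= => /andP[h ->]; rewrite (lt_le_trans _ h)// invr_gt0.
rewrite FE.
have cont (b x : R) : 0 < x -> {for x, continuous (fun y : R => y `^ b)}.
  move=> x0; apply/differentiable_continuous/derivable1_diffP.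
  by apply: derivable_powR; rewrite in_itv/= x0.
have mf D : measurable_fun D (fun t : R => (a * t `^ (a - 1))%:E).
  apply: measurable_funTS; apply/measurable_EFinP; exact: measurable_funM.
have cv : (\int[lambda]_(x in F k) (a * x `^ (a - 1))%:E)%E @[k --> \oo] -->
    (\int[lambda]_(x in \bigcup_k F k) (a * x `^ (a - 1))%:E)%E.
  apply: ge0_nondecreasing_set_cvg_integral => //.
  - apply/nondecreasing_seqP => k; apply/subsetPset => t.
    rewrite /F/= !in_itv/= => /andP[h ->]; rewrite andbT (le_trans _ h)//.
    by rewrite lef_pV2 ?posrE// ler_nat.
  - by move=> k; exact: measurable_itv.
  - by move=> k; exact: mf.
  - by move=> k t _; rewrite lee_fin mulr_ge0 ?powR_ge0// ltW.
rewrite -(cvg_lim _ cv)//; apply: lime_le; first by apply/cvg_ex; eexists; exact: cv.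
apply: nearW => k; have k0 : 0 < k.+2%:R^-1 :> R by rewrite invr_gt0.
have k1 : k.+2%:R^-1 < 1 :> R by rewrite invf_lt1// ltr1n.
rewrite (@continuous_FTC2 _ _ (fun x => x `^ a))//.
- by rewrite powR1 -EFinB lee_fin lerBlDr lerDl powR_ge0.
- apply: continuous_in_subspaceT => x; rewrite inE/= in_itv/= => /andP[kx _].
  apply: cvgM; first exact: cvg_cst.
  exact/cont/(lt_le_trans k0).
- split.
  + move=> x; rewrite in_itv/= => /andP[kx _]; apply: derivable_powR.
    by rewrite in_itv/= (lt_trans k0).
  + exact/cvg_at_right_filter/cont.
  + exact/cvg_at_left_filter/cont.
- move=> x; rewrite in_itv/= => /andP[kx _].
  by rewrite powR_derive1// in_itv/= (lt_trans k0).
Qed.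

Lemma gamma_integral_lty (a : R) : 0 < a -> (gamma_integral a < +oo)%E.
Proof.
move=> a0; rewrite /gamma_integral.
have U : `]0, +oo[%classic = `]0, 1]%classic `|` `]1, +oo[%classic :> set R.
  apply/seteqP; split=> t /=; rewrite !in_itv/= ?andbT.
    by move=> t0; have [t1|t1] := leP t 1; [left|right]; rewrite ?t0.
  by case=> [/andP[]//|]; exact: lt_trans.
rewrite U ge0_integral_setU//; last 3 first.
- exact: measurable_gamma_integrand1.
- by move=> t _; rewrite lee_fin mulr_ge0 ?powR_ge0 ?expR_ge0.
- by apply/disj_setPS => t [] /=; rewrite !in_itv/= => /andP[_ t1] /andP[/(le_lt_trans t1)]; rewrite ltxx.
(* From t/(2a) <= exp(t/(2a)), raised to the power a: t^a <= K exp(t/2). On ]1, +oo[ the integrand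
   is then at most K exp(-t/2), which is 2K times the exponential density of rate 1/2. *)
pose K := (2 * a) `^ a.
apply: (@le_lt_trans _ _ ((a^-1)%:E + (2 * K)%:E)%E); last by rewrite ltry.
apply: leeD.
  apply: (@le_trans _ _ (\int[lambda]_(t in `]0%R, 1%R]) ((a^-1)%:E * (a * t `^ (a - 1))%:E))%E).
    apply: ge0_le_integral => //.
    - by move=> t _; rewrite lee_fin mulr_ge0 ?powR_ge0 ?expR_ge0.
    - exact: measurable_gamma_integrand1.
    - apply: measurable_funTS; apply: emeasurable_funM => //.
      apply/measurable_EFinP; exact: measurable_funM.
    - move=> t /=; rewrite in_itv/= => /andP[t0 _].
      rewrite -EFinM mulrA mulVf ?gt_eqF// mul1r lee_fin ler_piMr ?powR_ge0//.
      by rewrite -expR0 ler_expR oppr_le0 ltW.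
  rewrite ge0_integralZl//; last 3 first.
  - apply: measurable_funTS; apply/measurable_EFinP; exact: measurable_funM.
  - by move=> t _; rewrite lee_fin mulr_ge0 ?powR_ge0// ltW.
  - by rewrite lee_fin invr_ge0 ltW.
  rewrite -[leRHS]mule1 lee_wpmul2l ?lee_fin ?invr_ge0 ?(ltW a0)//.
  exact: integral_powR_le1.
have h2 : 0 < 2^-1 :> R by rewrite invr_gt0.
apply: (@le_trans _ _ (\int[lambda]_t ((2 * K)%:E * (exponential_pdf 2^-1 t)%:E))%E); last first.
  rewrite ge0_integralZl//; last 3 first.
  - by apply/measurable_EFinP; exact: measurable_exponential_pdf.
  - by move=> t _; rewrite lee_fin exponential_pdf_ge0// ltW.
  - by rewrite lee_fin mulr_ge0 ?powR_ge0.
  by rewrite integral_exponential_pdf// mule1.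
have mE : measurable_fun [set: R] (fun t => ((2 * K)%:E * (exponential_pdf 2^-1 t)%:E)%E).
  by apply: emeasurable_funM => //; apply/measurable_EFinP; exact: measurable_exponential_pdf.
have E0 t : (0 <= (2 * K)%:E * (exponential_pdf 2^-1 t)%:E)%E.
  by rewrite mule_ge0 ?lee_fin ?mulr_ge0 ?powR_ge0// exponential_pdf_ge0// ltW.
apply: (@le_trans _ _ (\int[lambda]_(t in `]1%R, +oo[) ((2 * K)%:E * (exponential_pdf 2^-1 t)%:E))%E); last first.
  exact: ge0_subset_integral.
apply: ge0_le_integral => //.
- by move=> t _; rewrite lee_fin mulr_ge0 ?powR_ge0 ?expR_ge0.
- exact: measurable_gamma_integrand1.
- exact: measurable_funTS.
- move=> t /=; rewrite in_itv/= andbT => t1.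
  have t0 : 0 < t by rewrite (lt_trans _ t1).
  rewrite -EFinM lee_fin exponential_pdfE ?(ltW t0)//=.
  rewrite (mulrC 2) mulrA -(mulrA K) mulfV ?mulr1//.
  have -> : expR (- 2^-1 * t) = expR (2^-1 * t) * expR (- t).
    by rewrite -expRD; congr expR; field.
  rewrite mulrA ler_wpM2r ?expR_ge0//.
  apply: (@le_trans _ _ (t `^ a)).
    by apply: ler_powR; [exact: ltW|move: a0; clear; lra].
  have a20 : 0 < 2 * a by rewrite mulr_gt0.
  have -> : t = (2 * a) * (t / (2 * a)) by rewrite mulrCA mulfV ?mulr1// gt_eqF.
  rewrite {1}powRM ?divr_ge0 ?(ltW a20) ?(ltW t0)// ler_wpM2l ?powR_ge0//.
  have -> : 2^-1 * (2 * a * (t / (2 * a))) = t / (2 * a) * a by field; rewrite gt_eqF.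
  rewrite expRM; apply: ge0_ler_powR; rewrite ?nnegrE ?divr_ge0 ?expR_ge0 ?(ltW a20) ?(ltW t0) ?(ltW a0)//.
  by rewrite (le_trans _ (expR_ge1Dx _))// lerDr.
Qed.

Lemma GammaE (a : R) : 0 < a -> gamma_integral a = (Gamma a)%:E.
Proof.
move=> a0; rewrite /Gamma -/(gamma_integral a) fineK//.
by rewrite ge0_fin_numE ?gamma_integral_lty// ltW// gamma_integral_gt0.
Qed.

Lemma Gamma_gt0 (a : R) : 0 < a -> 0 < Gamma a.
Proof. by move=> a0; rewrite -lte_fin -GammaE// gamma_integral_gt0. Qed.

End gamma_finite.

(** * The kernel integrates to one *)

Section sigma_finite_copy.
Context {dd} {T : measurableType dd} {R : realType}.
Variables (m : {measure set T -> \bar R}) (hm : sigma_finite setT m).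

(** The same measure, carrying the sigma-finite structure that Fubini-Tonelli requires. *)
Definition sigma_finite_copy of sigma_finite setT m : set T -> \bar R := m.

HB.instance Definition _ := isMeasure.Build _ _ _ (sigma_finite_copy hm)
  (measure0 m) (measure_ge0 m) (@measure_semi_sigma_additive _ _ _ m).
HB.instance Definition _ := Measure_isSigmaFinite.Build _ _ _ (sigma_finite_copy hm) hm.

End sigma_finite_copy.

Section normalization.
Context {R : realType}.
Local Notation lambda := (@lebesgue_measure R).

Lemma lebesgue_sigma_finite {n} (leb : {measure set (n.-tuple R) -> \bar R}) :
  is_lebesgue_measure leb -> sigma_finite setT leb.
Proof.
move=> Hleb; exists (fun k => cube [tuple 0 | i < n] k%:R).
  apply/esym; rewrite -subTset => y _.
  have s0 : 0 <= \sum_(i < n) `|tnth y i| by exact: sumr_ge0.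
  exists (Num.truncn (\sum_(i < n) `|tnth y i|)).+1 => // i.
  have : `|tnth y i| < (Num.truncn (\sum_(i < n) `|tnth y i|)).+1%:R.
    apply: le_lt_trans (truncnS_gt _).
    by rewrite (bigD1 i)//= lerDl sumr_ge0.
  by rewrite ltr_norml tnth_mktuple => /andP[h1 h2]; rewrite sub0r add0r h1/= ltW.
move=> k; split; first exact: measurable_cube.
by rewrite lebesgue_cube// ltry.
Qed.

Lemma measurable_sqdist {n} (x : n.-tuple R) : measurable_fun setT (sqdist x).
Proof.
apply: measurable_sum => i; apply: measurable_funX; apply: measurable_funB => //.
exact: measurable_tnth.
Qed.

Lemma sqdist_ge0 {n} (x y : n.-tuple R) : 0 <= sqdist x y.
Proof. by apply: sumr_ge0 => i _; exact: sqr_ge0. Qed.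

(** Integrating out the n Gaussian variables lowers the exponent of u by n/2, which turns the
    integrand of Gamma((n+s)/2) into that of Gamma(s/2). *)
Lemma gauss_weight (n : nat) (u s : R) : 0 < u ->
  Num.sqrt (pi / u) ^+ n * u `^ ((n%:R + s) / 2 - 1) = pi `^ (n%:R / 2) * u `^ (s / 2 - 1).
Proof.
move=> u0; have pi0 := @pi_gt0 R.
have -> : Num.sqrt (pi / u) ^+ n = pi `^ (n%:R / 2) * u `^ (- (n%:R / 2)).
  rewrite -powR12_sqrt ?divr_ge0 ?ltW// -powR_mulrn ?powR_ge0// -powRrM.
  rewrite powRM ?invr_ge0 ?ltW// -(powR_inv1 (ltW u0)) -powRrM.
  by congr (_ `^ _ * _ `^ _); field.
rewrite -mulrA -powRD; last by rewrite (gt_eqF u0) implybT.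
by congr (_ * _ `^ _); field.
Qed.

Lemma C3E (d : nat) (alpha : R) : (2 <= d)%N ->
  C3 d alpha = pi `^ (- (d.-1%:R / 2)) * Gamma ((d.-1%:R + (alpha - 1)) / 2) /
    Gamma ((alpha - 1) / 2).
Proof.
move=> d2; have dE : d%:R = d.-1%:R + 1 :> R by rewrite natr1 prednK// ltnW.
by rewrite /C3 dE; congr (pi `^ _ * Gamma _ / _); field.
Qed.

Lemma C3_gt0 (d : nat) (alpha : R) : (2 <= d)%N -> 1 < alpha -> 0 < C3 d alpha.
Proof.
move=> d2 a1; have s0 : 0 < alpha - 1 by rewrite subr_gt0.
have pi0 : 0 < pi `^ (- (d.-1%:R / 2)) :> R by rewrite powR_gt0 ?pi_gt0.
have h1 : 0 < (d.-1%:R + (alpha - 1)) / 2 by rewrite divr_gt0// ltr_wpDl.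
have h2 : 0 < (alpha - 1) / 2 by rewrite divr_gt0.
rewrite (C3E _ _ d2); exact: divr_gt0 (mulr_gt0 pi0 (Gamma_gt0 _ h1)) (Gamma_gt0 _ h2).
Qed.

(* Write [(|x-y|^2+t^2)^(-a)] as a Gamma integral in [u] and exchange the order of
   integration: the y-integral becomes Gaussian. *)
Lemma integral_power_kernel {n} (leb : {measure set (n.-tuple R) -> \bar R})
    (x : n.-tuple R) (t s : R) : is_lebesgue_measure leb -> 0 < s -> t != 0 ->
  ((Gamma ((n%:R + s) / 2))%:E *
    \int[leb]_y ((sqdist x y + t ^+ 2) `^ (- ((n%:R + s) / 2)))%:E =
   (pi `^ (n%:R / 2) * (t ^+ 2) `^ (- (s / 2)) * Gamma (s / 2))%:E)%E.
Proof.
move=> Hleb s0 t0; pose a := (n%:R + s) / 2.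
have t20 : 0 < t ^+ 2 by rewrite exprn_even_gt0.
have a0 : 0 < a by rewrite divr_gt0// ltr_wpDl.
have D20 y : 0 < sqdist x y + t ^+ 2 by rewrite ltr_wpDl// sqdist_ge0.
have G0 := Gamma_gt0 a a0.
pose m2 := sigma_finite_copy leb (lebesgue_sigma_finite leb Hleb).
(* The indicator extends the half-line integral to the whole line, where Tonelli is applied. *)
pose A (u : R) := \1_(`]0, +oo[%classic) u * (u `^ (a - 1) * expR (- (t ^+ 2 * u))).
have A0 u : 0 <= A u by rewrite !mulr_ge0 ?powR_ge0 ?expR_ge0.
have mA : measurable_fun [set: measurableTypeR R] A.
  apply: measurable_funM; first exact: measurable_indic.
  apply/measurable_EFinP; exact: measurable_gamma_integrand.
pose G (u : R) y := expR (- (u * sqdist x y)).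
pose f (z : measurableTypeR R * n.-tuple R) : \bar R := (A z.1 * G z.1 z.2)%:E.
have mf : measurable_fun setT f.
  apply/measurable_EFinP; apply: measurable_funM; first exact: measurableT_comp.
  apply: measurableT_comp => //; apply: measurable_funN; apply: measurable_funM => //.
  by apply: measurableT_comp => //; exact: measurable_sqdist.
have f0 z : (0 <= f z)%E by rewrite lee_fin mulr_ge0// expR_ge0.
have := @fubini_tonelli _ _ _ _ R lambda m2 f mf f0.
have -> : (\int[m2]_y \int[lambda]_u f (u, y) =
    (Gamma a)%:E * \int[leb]_y ((sqdist x y + t ^+ 2) `^ (- a))%:E)%E.
  rewrite -ge0_integralZl//; last 3 first.
  - apply/measurable_EFinP; apply: (measurableT_comp (measurable_powR _)).
    by apply: measurable_funD => //; exact: measurable_sqdist.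
  - by move=> y _; rewrite lee_fin powR_ge0.
  - by rewrite lee_fin ltW.
  apply: eq_integral => y _.
  rewrite muleC -(GammaE _ a0) -(gamma_integral_scale a _ (D20 y)) [RHS]integral_mkcond.
  apply: eq_integral => u _; rewrite /f/= /A /G indicE patchE.
  case: ifPn => _; last by rewrite !mul0r.
  by rewrite mul1r -mulrA -expRD; congr (_ * expR _)%:E; ring.
have -> : (\int[lambda]_u \int[m2]_y f (u, y) =
    (pi `^ (n%:R / 2) * (t ^+ 2) `^ (- (s / 2)) * Gamma (s / 2))%:E)%E.
  have s20 : 0 < s / 2 by rewrite divr_gt0.
  rewrite -[X in X%:E]mulrA EFinM [X in (_ * X)%E]EFinM -(GammaE _ s20).
  rewrite -(gamma_integral_scale (s / 2) (t ^+ 2) t20).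
  rewrite -ge0_integralZl//; last 3 first.
  - exact: measurable_gamma_integrand.
  - by move=> u _; rewrite lee_fin mulr_ge0 ?powR_ge0 ?expR_ge0.
  - by rewrite lee_fin powR_ge0.
  rewrite [RHS]integral_mkcond; apply: eq_integral => u _.
  rewrite patchE /f/=; under eq_integral do rewrite EFinM.
  rewrite ge0_integralZl//; last 3 first.
  - apply/measurable_EFinP; apply: measurableT_comp => //; apply: measurable_funN.
    by apply: measurable_funM => //; exact: measurable_sqdist.
  - by move=> y _; rewrite lee_fin expR_ge0.
  - by rewrite lee_fin.
  rewrite /A indicE; case: ifPn => [|_]; last by rewrite mul0r mul0e.
  rewrite inE/= in_itv/= andbT => u0; rewrite mul1r.
  have -> : (\int[m2]_y (G u y)%:E = (\prod_(i < n) Num.sqrt (pi / u))%:E)%E.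
    rewrite -(integral_prod_tnth leb Hleb
      (fun i y => expR (- (u * (tnth x i - y) ^+ 2)))); last first.
      by move=> i; exact: has_integral_gauss.
    apply: eq_integral => y _; congr EFin.
    by rewrite /G /sqdist mulr_sumr -sumrN expR_sum.
  rewrite prodr_const card_ord -!EFinM; congr EFin.
  by rewrite [LHS]mulrC [LHS]mulrA /a gauss_weight// -[LHS]mulrA.
by move=> <-.
Qed.

Lemma measurable_omega_density d alpha :
  measurable_fun setT (@omega_density R d alpha).
Proof.
apply: measurable_funM => //; apply: (measurableT_comp (measurable_powR _)).
apply: measurableT_comp; first by apply: continuous_measurable_fun; exact: sqrt_continuous.
apply: measurable_funD => //; apply: measurable_sum => i; apply: measurable_funX.
exact: measurable_tnth.
Qed.

(** The factor |e_d - y|^(d+alpha-2) of the kernel cancels against the density, leaving a function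
    of the distance to (x, t) alone. *)
Lemma MH_kernel_omega_density d alpha (x y : (d.-1).-tuple R) t : t != 0 ->
  MH_kernel d alpha x t y * omega_density d alpha y =
  C3 d alpha * `|t| `^ (alpha - 1) *
    (sqdist x y + t ^+ 2) `^ (- ((d%:R + alpha - 2) / 2)).
Proof.
move=> t0; rewrite /MH_kernel /omega_density.
move: (C3 d alpha) (d%:R + alpha - 2) (alpha - 1) => c p s.
have D20 : 0 < sqdist x y + t ^+ 2.
  by rewrite ltr_wpDl ?sqdist_ge0// exprn_even_gt0.
have -> : distL x t y `^ p = (sqdist x y + t ^+ 2) `^ (p / 2).
  by rewrite /distL -powR12_sqrt ?ltW// -powRrM mulrC.
have h1 : dist_ed y `^ p != 0 by rewrite gt_eqF// powR_gt0// dist_ed_gt0.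
have h2 : (sqdist x y + t ^+ 2) `^ (p / 2) != 0 by rewrite gt_eqF// powR_gt0.
by rewrite !powRN; field; rewrite h1 h2.
Qed.

Lemma integral_MH_kernel_lebesgue d alpha
    (leb omega : {measure set ((d.-1).-tuple R) -> \bar R})
    (x : (d.-1).-tuple R) (t : R) : 0 < @C3 R d alpha ->
  (forall A, measurable A ->
     omega A = (\int[leb]_(x in A) (omega_density d alpha x)%:E)%E) ->
  t != 0 -> (\int[omega]_y (MH_kernel d alpha x t y)%:E =
    (C3 d alpha * `|t| `^ (alpha - 1))%:E *
    \int[leb]_y ((sqdist x y + t ^+ 2) `^ (- ((d%:R + alpha - 2) / 2)))%:E)%E.
Proof.
move=> C30 omE t0.
have w0 y : 0 <= @omega_density R d alpha y := mulr_ge0 (ltW C30) (powR_ge0 _ _).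
have Ct0 : (0 <= (C3 d alpha * `|t| `^ (alpha - 1))%:E)%E.
  by rewrite lee_fin; exact: mulr_ge0 (ltW C30) (powR_ge0 _ _).
clear C30.
rewrite (integral_density leb (omega_density d alpha) (measurable_omega_density _ _) w0 _ _ omE);
  first last.
- by move=> y; rewrite lee_fin !mulr_ge0 ?invr_ge0 ?powR_ge0.
- by apply/measurable_EFinP; exact: measurable_MH_kernel.
rewrite -ge0_integralZl //; first last.
- by move=> y _; rewrite lee_fin powR_ge0.
- apply/measurable_EFinP; apply: (measurableT_comp (measurable_powR _)).
  by apply: measurable_funD => //; exact: measurable_sqdist.
by apply: eq_integral => y _; rewrite -!EFinM MH_kernel_omega_density.
Qed.

Lemma integral_MH_kernel d alpha (leb omega : {measure set ((d.-1).-tuple R) -> \bar R})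
    (x : (d.-1).-tuple R) (t : R) :
  (2 <= d)%N -> 1 < alpha -> is_lebesgue_measure leb ->
  (forall A, measurable A ->
     omega A = (\int[leb]_(x in A) (omega_density d alpha x)%:E)%E) ->
  t != 0 -> (\int[omega]_y (MH_kernel d alpha x t y)%:E = 1)%E.
Proof.
move=> d2 a1 Hleb omE t0.
rewrite (integral_MH_kernel_lebesgue d alpha leb omega x t (C3_gt0 d alpha d2 a1) omE t0).
pose s := alpha - 1; have s0 : 0 < s by rewrite subr_gt0.
have -> : d%:R + alpha - 2 = d.-1%:R + s.
  by rewrite -[in LHS](prednK (ltnW d2)) -natr1 /s; ring.
rewrite (C3E d alpha d2) -/s.
have ns0 : 0 < (d.-1%:R + s) / 2 by rewrite divr_gt0// ltr_wpDl.
have := integral_power_kernel leb x t s Hleb s0 t0.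
have := Gamma_gt0 _ ns0.
have s20 : 0 < s / 2 by rewrite divr_gt0.
have := Gamma_gt0 _ s20.
move: (Gamma ((d.-1%:R + s) / 2)) (Gamma (s / 2)) (integral _ _ _) => g1 g2 I g20 g10.
move/(congr1 (mule g1^-1%:E)).
rewrite muleA -EFinM mulVf ?gt_eqF// mul1e => ->.
rewrite -!EFinM; congr EFin.
have tE : (t ^+ 2) `^ (- (s / 2)) = (`|t| `^ s)^-1.
  by rewrite -powRN -real_normK ?num_real// -powR_mulrn// -powRrM; congr (_ `^ _); field.
have ts : `|t| `^ s != 0 by rewrite gt_eqF// powR_gt0// normr_gt0.
have pin : 0 < pi `^ (d.-1%:R / 2) :> R by rewrite powR_gt0 ?pi_gt0.
rewrite tE powRN; field.
by rewrite ts !gt_eqF.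
Qed.

End normalization.

(** * Decomposition of the charge *)

Section finite_copy.
Context {dd} {T : measurableType dd} {R : realType}.
Variables (m : {measure set T -> \bar R}) (hm : fin_num_fun m).

Definition finite_copy of fin_num_fun m : set T -> \bar R := m.

HB.instance Definition _ := isMeasure.Build _ _ _ (finite_copy hm)
  (measure0 m) (measure_ge0 m) (@measure_semi_sigma_additive _ _ _ m).
HB.instance Definition _ := Measure_isFinite.Build _ _ _ (finite_copy hm) hm.

End finite_copy.

Lemma density_measure_fin {dd} {T : measurableType dd} {R : realType}
    (m : {measure set T -> \bar R}) (w : T -> R)
    (mw : measurable_fun setT w) (w0 : forall x, 0 <= w x) :
  m.-integrable setT (EFin \o w) -> fin_num_fun (density_measure m w mw w0).
Proof. by move=> iw A mA; apply: integrable_fin_num => //; exact: integrableS iw. Qed.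

Section decomposition.
Context {dd} {T : measurableType dd} {R : realType}.

Lemma charge_jordanE (mu : {charge set T -> \bar R}) (P N : set T)
    (h : hahn_decomposition mu P N) A : measurable A ->
  mu A = (jordan_pos h A - jordan_neg h A)%E.
Proof. by move=> mA; rewrite (jordan_decomp h mA) /cadd/= cscaleN1. Qed.

Lemma ge0_integral_bounded_fin_num (m : {finite_measure set T -> \bar R})
    (g : T -> R) (M : R) :
  measurable_fun setT g -> (forall x, 0 <= g x) -> (forall x, g x <= M) ->
  (\int[m]_x (g x)%:E)%E \is a fin_num.
Proof.
move=> mg g0 gM; rewrite ge0_fin_numE; last first.
  by apply: integral_ge0 => x _; rewrite lee_fin.
apply: (@le_lt_trans _ _ (\int[m]_x M%:E)%E).
  apply: ge0_le_integral => //.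
  - by move=> x _; rewrite lee_fin.
  - exact/measurable_EFinP.
  - by move=> x _; rewrite lee_fin.
rewrite integral_cst// ltey_eq fin_numM//; exact: fin_num_measure.
Qed.

(* Both sides of [mu^+ + nu^- + N.omega = mu^- + nu^+ + P.omega] are measures. *)
Lemma integral_decomposition (omega : {measure set T -> \bar R})
    (mu nu : {charge set T -> \bar R}) (P Q P' Q' : set T)
    (hmu : hahn_decomposition mu P Q) (hnu : hahn_decomposition nu P' Q')
    (f p q g : T -> R) :
  (forall x, f x = p x - q x) ->
  omega.-integrable setT (EFin \o p) -> omega.-integrable setT (EFin \o q) ->
  (forall x, 0 <= p x) -> (forall x, 0 <= q x) ->
  (forall A, measurable A -> mu A = (\int[omega]_(x in A) (f x)%:E + nu A)%E) ->
  measurable_fun setT g -> (forall x, 0 <= g x) ->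
  (\int[jordan_pos hmu]_x (g x)%:E + (\int[jordan_neg hnu]_x (g x)%:E +
     \int[omega]_x ((g x)%:E * (q x)%:E)) =
   \int[jordan_neg hmu]_x (g x)%:E + (\int[jordan_pos hnu]_x (g x)%:E +
     \int[omega]_x ((g x)%:E * (p x)%:E)))%E.
Proof.
move=> fE ip iq p0 q0 muE mg g0.
have mp : measurable_fun setT p by apply/measurable_EFinP; exact: measurable_int ip.
have mq : measurable_fun setT q by apply/measurable_EFinP; exact: measurable_int iq.
have mgE : measurable_fun setT (EFin \o g) by exact/measurable_EFinP.
have g0E x : (0 <= (EFin \o g) x)%E by rewrite lee_fin.
rewrite -(integral_density omega p mp p0 (density_measure omega p mp p0) (EFin \o g))//.
rewrite -(integral_density omega q mq q0 (density_measure omega q mq q0) (EFin \o g))//.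
have g0T x : setT x -> (0 <= (g x)%:E)%E by rewrite lee_fin.
rewrite -!ge0_integral_measure_add//.
(* It remains to compare the two sum measures on each [A], where all six values are finite and terms
   can change sides. *)
apply: eq_measure_integral => A mA _.
rewrite /= /msum !big_ord_recl !big_ord0 /= /msum !big_ord_recl !big_ord0 /= !adde0.
have := muE A mA; rewrite (charge_jordanE mu _ _ hmu)// (charge_jordanE nu _ _ hnu)//.
have iA r : omega.-integrable setT (EFin \o r) -> omega.-integrable A (EFin \o r).
  by move=> ir; apply: integrableS ir.
have -> : (\int[omega]_(x in A) (f x)%:E =
    density_measure omega p mp p0 A - density_measure omega q mq q0 A)%E.
  under eq_integral do rewrite fE EFinB.
  by rewrite integralB_EFin//; exact: iA.
have fp : density_measure omega p mp p0 A \is a fin_num.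
  by apply: integrable_fin_num => //; exact: iA.
have fq : density_measure omega q mq q0 A \is a fin_num.
  by apply: integrable_fin_num => //; exact: iA.
have : jordan_pos hmu A \is a fin_num by exact: fin_num_measure.
have : jordan_neg hmu A \is a fin_num by exact: fin_num_measure.
have : jordan_pos hnu A \is a fin_num by exact: fin_num_measure.
have : jordan_neg hnu A \is a fin_num by exact: fin_num_measure.
move: fp fq.
move: (density_measure omega p mp p0 A) (density_measure omega q mq q0 A)
  (jordan_pos hmu A) (jordan_neg hmu A) (jordan_pos hnu A) (jordan_neg hnu A).
move=> a b c e u v.
do 6![move=> /fineK <-].
rewrite -!EFinB -!EFinD => -[h]; congr EFin; lra.
Qed.

End decomposition.

(** * The nontangential limit *)

Section nontangential.
Context {R : realType} (d : nat) (alpha : R).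
Local Notation V := ((d.-1).-tuple R).
Hypotheses (d2 : (2 <= d)%N) (a1 : 1 < alpha).
Variables (leb omega : {measure set V -> \bar R}).
Hypothesis Hleb : is_lebesgue_measure leb.
Hypothesis omE : forall A, measurable A ->
  omega A = (\int[leb]_(x in A) (omega_density d alpha x)%:E)%E.

Let kernel_exponent_ge0 : 0 <= d%:R + alpha - 2.
Proof.
have d2R : 2 <= d%:R :> R by rewrite ler_nat.
by rewrite subr_ge0 (le_trans d2R)// lerDl (le_trans _ (ltW a1)).
Qed.

Lemma MH_kernel_ge0 x t y : 0 <= MH_kernel d alpha x t y.
Proof. by rewrite !mulr_ge0 ?invr_ge0 ?powR_ge0. Qed.

(** |e_d - y| grows at most linearly in |x-y|, and |x-y| is at least |t|. This makes every integral
    of the kernel against a finite measure finite. *)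
Lemma MH_kernel_bounded x t : t != 0 ->
  exists M, forall y, MH_kernel d alpha x t y <= M.
Proof.
move=> t0; pose S := 1 + \sum_(i < d.-1) `|tnth x i|.
have S0 : 0 <= S by rewrite addr_ge0// sumr_ge0.
have T0 : 0 < `|t| by rewrite normr_gt0.
exists (`|t| `^ (alpha - 1) * (S / `|t| + d.-1%:R) `^ (d%:R + alpha - 2)) => y.
apply: MH_kernel_le => //; apply: (le_trans (dist_ed_le y)).
have hD := ler_distL_height x y t.
rewrite mulrDl; apply: (@le_trans _ _ (S + d.-1%:R * distL x t y)); last first.
  by rewrite lerD2r -mulrA ler_peMr// mulrC ler_pdivlMr// mul1r.
rewrite /S -addrA lerD2l.
have -> : d.-1%:R * distL x t y = \sum_(i < d.-1) distL x t y.
  by rewrite sumr_const card_ord mulr_natl.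
rewrite -big_split/=; apply: ler_sum => i _.
have := ler_normD (tnth x i) (tnth y i - tnth x i).
rewrite (addrC _ (_ - _)) subrK => /le_trans; apply.
by rewrite lerD2l distrC ler_distL.
Qed.

(** At the point e_d, that is (0, 1), the kernel is identically 1, so its normalization is the total
    mass. *)
Lemma omega_setT : omega setT = 1%E.
Proof.
have := integral_MH_kernel d alpha leb omega [tuple 0 | i < d.-1] 1 d2 a1 Hleb omE (oner_neq0 _).
move=> <-; rewrite -[LHS]mul1e -integral_cst//; apply: eq_integral => y _ /=.
congr EFin; rewrite /MH_kernel normr1 powR1 mul1r.
have -> : distL [tuple 0 | i < d.-1] 1 y = dist_ed y.
  rewrite /distL expr1n; congr (Num.sqrt (_ + 1)); apply: eq_bigr => i _.
  by rewrite tnth_mktuple sub0r sqrrN.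
by rewrite mulfV// gt_eqF// powR_gt0// dist_ed_gt0.
Qed.

(** The density is strictly positive. This makes the [omega]-null set carrying [nu] negligible for
    Lebesgue measure. *)
Lemma leb_null A : measurable A -> omega A = 0%E -> leb A = 0%E.
Proof.
move=> mA; rewrite omE// => h.
have w0 (y : V) : 0 < omega_density d alpha y.
  by rewrite mulr_gt0 ?C3_gt0// powR_gt0// dist_ed_gt0.
apply/eqP/negPn/negP => lA0.
have mw : measurable_fun A (EFin \o (@omega_density R d alpha)).
  by apply/measurable_EFinP; apply: measurable_funTS; exact: measurable_omega_density.
have := (ae_eq_integral_abs leb mA mw).1.
have -> : (\int[leb]_(x in A) `|(EFin \o omega_density d alpha) x| = 0)%E.
  by rewrite -h; apply: eq_integral => y _ /=; rewrite ger0_norm// ltW.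
move=> /(_ erefl)[N [mN N0 AN]]; move/eqP: lA0; apply.
apply/eqP; rewrite eq_le measure_ge0 andbT -N0; apply: le_measure; rewrite ?inE// => y Ay.
by apply: AN => /= /(_ Ay) [] /eqP; rewrite gt_eqF.
Qed.

Variable w : V -> R.
Hypotheses (mw : measurable_fun setT w) (w0 : forall y, 0 <= w y).
Hypothesis iw : omega.-integrable setT (EFin \o w).

Local Notation wom :=
  (finite_copy (density_measure omega w mw w0) (density_measure_fin omega w mw w0 iw)).

Lemma density_zero_density_ae (A : set V) : measurable A -> (forall y, A y -> w y = 0) ->
  {ae leb, forall y, A y -> zero_density wom y}.
Proof.
move=> mA wA0.
have n0 : (0 < d.-1)%N by rewrite -ltnS prednK// ltnW.
have wA : wom A = 0%E.
  suff : (\int[omega]_(x in A) (w x)%:E = 0)%E by [].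
  rewrite (eq_integral (cst 0%E)) ?integral0//.
  by move=> y; rewrite inE => /wA0 ->.
apply: negligibleS (zero_density_ae leb wom Hleb n0 A mA wA) => y /= /not_implyP[Ay zy].
by split.
Qed.

Lemma density_kernel_vanish y0 : zero_density wom y0 ->
  forall beta : R, 0 < beta -> forall eps : R, 0 < eps ->
  exists2 delta : R, 0 < delta & forall (x : V) (t : R), t != 0 ->
    distL x t y0 < (1 + beta) * `|t| -> distL x t y0 < delta ->
    (\int[omega]_y ((MH_kernel d alpha x t y)%:E * (w y)%:E) <= eps%:E)%E.
Proof.
move=> zy beta b0 eps e0.
have [delta delta0 hd] := MH_kernel_vanish d alpha wom y0 d2 a1 zy beta b0 eps e0.
exists delta => // x t t0 h1 h2; have := hd x t t0 h1 h2.
rewrite (integral_density omega w mw w0 wom)//.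
- by apply/measurable_EFinP; exact: measurable_MH_kernel.
- by move=> y; rewrite lee_fin MH_kernel_ge0.
Qed.

End nontangential.

Section singular_part.
Context {dd} {T : measurableType dd} {R : realType}.

(** The Jordan parts evaluate [nu] on the traces of [A] on [P] and [N], which are subsets of [A]. *)
Lemma jordan_null (nu : {charge set T -> \bar R}) (P N : set T)
    (h : hahn_decomposition nu P N) (A : set T) : measurable A ->
  (forall B, measurable B -> B `<=` A -> nu B = 0%E) ->
  jordan_pos h A = 0%E /\ jordan_neg h A = 0%E.
Proof.
move=> mA nuA; have [[mP _] [mN _] _ _] := h.
have nuI B : measurable B -> nu (A `&` B) = 0%E.
  by move=> mB; apply: nuA; [exact: measurableI|exact: subIsetl].
rewrite jordan_posE cjordan_posE jordan_negE cjordan_negE /crestr0 mem_set//.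
by rewrite /crestr !nuI// oppe0.
Qed.

End singular_part.

(** * Comparison of the charge with a multiple of the reference measure *)

Section excess.
Context {dd} {T : measurableType dd} {R : realType} (omega : {measure set T -> \bar R}).
Variable f : T -> R.
Hypotheses (intf : omega.-integrable setT (EFin \o f)) (omT : omega setT = 1%E).

Definition excess (q : R) (y : T) : R := Num.max (f y - q) 0.
Definition deficit (q : R) (y : T) : R := Num.max (q - f y) 0.

Lemma excess_ge0 q y : 0 <= excess q y. Proof. by rewrite le_max lexx orbT. Qed.

Lemma deficit_ge0 q y : 0 <= deficit q y. Proof. by rewrite le_max lexx orbT. Qed.

Let mf : measurable_fun setT f.
Proof. by apply/measurable_EFinP; exact: measurable_int intf. Qed.

Lemma measurable_excess q : measurable_fun setT (excess q).
Proof. by apply: measurable_maxr => //; exact: measurable_funB. Qed.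

Lemma measurable_deficit q : measurable_fun setT (deficit q).
Proof. by apply: measurable_maxr => //; exact: measurable_funB. Qed.

Lemma integrable_cst_mass1 (q : R) : omega.-integrable setT (EFin \o (fun=> q)).
Proof.
apply/integrableP; split; first by apply/measurable_EFinP; exact: measurable_cst.
rewrite (eq_integral (cst `|q|%:E)); last by move=> y _.
by rewrite integral_cst// [X in (_ * X)%E]omT mule1 ltry.
Qed.

Let integrable_max0 (h : T -> R) : omega.-integrable setT (EFin \o h) ->
  omega.-integrable setT (EFin \o (fun y => Num.max (h y) 0)).
Proof.
move=> ih; apply: (le_integrable measurableT _ _ ih).
  apply/measurable_EFinP; apply: measurable_maxr => //; apply/measurable_EFinP.
  exact: measurable_int ih.
move=> y _ /=; rewrite lee_fin ger0_norm ?le_max ?lexx ?orbT//.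
by rewrite ge_max ler_norm normr_ge0.
Qed.

Lemma integrable_excess q : omega.-integrable setT (EFin \o excess q).
Proof.
apply: integrable_max0; have := integrableB measurableT intf (integrable_cst_mass1 q).
by apply: eq_integrable => // y _ /=.
Qed.

Lemma integrable_deficit q : omega.-integrable setT (EFin \o deficit q).
Proof.
apply: integrable_max0; have := integrableB measurableT (integrable_cst_mass1 q) intf.
by apply: eq_integrable => // y _ /=.
Qed.

(* Uses [f = (max q 0 + excess) - (max (-q) 0 + deficit)], a difference of
   nonnegative functions. *)
Lemma charge_integral_shift (mu nu : {charge set T -> \bar R}) (P N : set T)
    (hnu : hahn_decomposition nu P N) (g : T -> R) (M q : R) :
  (forall A, measurable A -> mu A = (\int[omega]_(x in A) (f x)%:E + nu A)%E) ->
  measurable_fun setT g -> (forall x, 0 <= g x) -> (forall x, g x <= M) ->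
  (\int[omega]_x (g x)%:E = 1)%E ->
  exists vp vm sp sm : R, [/\ (\int[jordan_pos hnu]_x (g x)%:E = vp%:E)%E,
    (\int[jordan_neg hnu]_x (g x)%:E = vm%:E)%E,
    (\int[omega]_x ((g x)%:E * (excess q x)%:E) = sp%:E)%E,
    (\int[omega]_x ((g x)%:E * (deficit q x)%:E) = sm%:E)%E &
    fine (charge_integral mu g) - q = vp + sp - (vm + sm)].
Proof.
move=> muE mg g0 gM g1; set hmu := projT2 (hahn_pair mu).
have fin_density (w : T -> R) (mw : measurable_fun setT w) (w0 : forall x, 0 <= w x) :
    omega.-integrable setT (EFin \o w) ->
    (\int[omega]_x ((g x)%:E * (w x)%:E))%E \is a fin_num.
  move=> iw; have := density_measure_fin omega w mw w0 iw => hfin.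
  rewrite -(integral_density omega w mw w0 (finite_copy _ hfin) (EFin \o g))//.
  - exact: ge0_integral_bounded_fin_num.
  - exact/measurable_EFinP.
have fe := fin_density _ (measurable_excess q) (excess_ge0 q) (integrable_excess q).
have fd := fin_density _ (measurable_deficit q) (deficit_ge0 q) (integrable_deficit q).
have fp := ge0_integral_bounded_fin_num (jordan_pos hnu) g M mg g0 gM.
have fm := ge0_integral_bounded_fin_num (jordan_neg hnu) g M mg g0 gM.
have fmp := ge0_integral_bounded_fin_num (jordan_pos hmu) g M mg g0 gM.
have fmm := ge0_integral_bounded_fin_num (jordan_neg hmu) g M mg g0 gM.
have shiftE (c : R) (w : T -> R) : 0 <= c -> measurable_fun setT w -> (forall x, 0 <= w x) ->
    (\int[omega]_x ((g x)%:E * (c + w x)%:E) =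
     c%:E + \int[omega]_x ((g x)%:E * (w x)%:E))%E.
  move=> c0 mw w0.
  have mgE : measurable_fun setT (EFin \o g) by exact/measurable_EFinP.
  have mwE : measurable_fun setT (EFin \o w) by exact/measurable_EFinP.
  rewrite -[X in (X + _)%E]mule1 -g1 -ge0_integralZl//; last by move=> x _; rewrite lee_fin.
  rewrite -ge0_integralD//.
  - by apply: eq_integral => x _; rewrite -!EFinM -EFinD; congr EFin; ring.
  - by move=> x _; rewrite mule_ge0 ?lee_fin.
  - exact: emeasurable_funM.
  - by move=> x _; rewrite mule_ge0 ?lee_fin.
  - exact: emeasurable_funM.
(* [q] may be negative; splitting it keeps both densities nonnegative, and the kernel integral 1
   turns each constant into itself. *)
pose qp := Num.max q 0; pose qm := Num.max (- q) 0.
have qp0 : 0 <= qp by rewrite le_max lexx orbT.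
have qm0 : 0 <= qm by rewrite le_max lexx orbT.
have qE : q = qp - qm by rewrite /qp /qm; case: (leP q 0); case: (leP (- q) 0); lra.
have fE x : f x = (qp + excess q x) - (qm + deficit q x).
  have : f x - q = excess q x - deficit q x.
    by rewrite /excess /deficit; case: (leP (f x - q) 0); case: (leP (q - f x) 0); lra.
  by move: qE; lra.
have int_shift (c : R) (w : T -> R) : omega.-integrable setT (EFin \o w) ->
    omega.-integrable setT (EFin \o (fun x => c + w x)).
  move=> iw; have := integrableD measurableT (integrable_cst_mass1 c) iw.
  by apply: eq_integrable => // y _ /=.
have := integral_decomposition omega mu nu _ _ _ _ hmu hnu f _ _ g fE
  (int_shift qp _ (integrable_excess q)) (int_shift qm _ (integrable_deficit q))
  (fun x => addr_ge0 qp0 (excess_ge0 q x)) (fun x => addr_ge0 qm0 (deficit_ge0 q x)) muE mg g0.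
rewrite !shiftE//; [|exact: measurable_excess|exact: excess_ge0
  |exact: measurable_deficit|exact: deficit_ge0].
rewrite /charge_integral -/hmu.
move: fe fd fp fm fmp fmm => /fineK <- /fineK <- /fineK <- /fineK <- /fineK <- /fineK <-.
rewrite -EFinB -!EFinD/= => -[h].
do 4 eexists; split; try reflexivity.
rewrite /=; move: h qE; clear; lra.
Qed.

End excess.

Theorem theorem4p18 (R : realType) (d : nat) (alpha : R)
  (leb omega : {measure set ((d.-1).-tuple R) -> \bar R})
  (mu nu : {charge set ((d.-1).-tuple R) -> \bar R})
  (f : (d.-1).-tuple R -> R) :
  (2 <= d)%N -> 1 < alpha < 2 ->
  is_lebesgue_measure leb ->
  (forall A, measurable A ->
     omega A = (\int[leb]_(x in A) (omega_density d alpha x)%:E)%E) ->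
  omega.-integrable [set: (d.-1).-tuple R] (fun x => (f x)%:E) ->
  charge_singular nu omega ->
  (forall A, measurable A ->
     mu A = (\int[omega]_(x in A) (f x)%:E + nu A)%E) ->
  {ae leb, forall yb, nontangential_limit (MH d alpha mu) yb (f yb)}.
Proof.
move=> d2 /andP[a1 _] Hleb omE intf [S [mS omS nuS]] muE.
have n0 : (0 < d.-1)%N by rewrite -ltnS prednK// ltnW.
have omT := omega_setT d alpha d2 a1 leb omega Hleb omE.
pose iE := integrable_excess omega f intf omT; pose iD := integrable_deficit omega f intf omT.
pose mE := measurable_excess omega f intf; pose mD := measurable_deficit omega f intf.
have mf : measurable_fun setT f by apply/measurable_EFinP; exact: measurable_int intf.
pose hn := projT2 (hahn_pair nu).
have [np0 nm0] := jordan_null nu _ _ hn (~` S) (measurableC mS) nuS.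
have aeS : {ae leb, forall y, ~ S y}.
  exists S; split => //; first exact: (leb_null d alpha d2 a1 leb omega omE).
  by move=> y /= /contrapT.
have aeP : {ae leb, forall y, (~` S) y -> zero_density (jordan_pos hn) y}.
  have := zero_density_ae leb (jordan_pos hn) Hleb n0 _ (measurableC mS) np0.
  by apply: negligibleS => y /= /not_implyP[].
have aeN : {ae leb, forall y, (~` S) y -> zero_density (jordan_neg hn) y}.
  have := zero_density_ae leb (jordan_neg hn) Hleb n0 _ (measurableC mS) nm0.
  by apply: negligibleS => y /= /not_implyP[].
pose zP (q : R) := zero_density (finite_copy _ (density_measure_fin omega _ (mE q) (excess_ge0 f q) (iE q))).
pose zN (q : R) := zero_density (finite_copy _ (density_measure_fin omega _ (mD q) (deficit_ge0 f q) (iD q))).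
(* The level is quantified inside the almost-everywhere statement, so that it may later depend on y
   and eps; countability of the rationals, through [pickle], allows this. *)
have aezP : {ae leb, forall y, forall q : rat, f y <= ratr q -> zP (ratr q) y}.
  have : {ae leb, forall y, forall k : nat, if unpickle k is Some q then
      (f @^-1` `]-oo, ratr q]%classic) y -> zP (ratr q) y else True}.
    apply: ae_foralln => k; case: unpickle => [q|]; last exact: aeW.
    apply: (density_zero_density_ae d d2 leb omega Hleb _ _ _ _ (f @^-1` `]-oo, ratr q]%classic)).
      by rewrite -[X in measurable X]setTI; exact: mf.
    by move=> y /=; rewrite in_itv/= ?andbT => fy; apply/max_idPr; rewrite subr_le0.
  apply: filterS => y hy q; have := hy (pickle q); rewrite pickleK => {}hy fy.
  by apply: hy; rewrite /= in_itv/= ?andbT.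
have aezN : {ae leb, forall y, forall q : rat, ratr q <= f y -> zN (ratr q) y}.
  have : {ae leb, forall y, forall k : nat, if unpickle k is Some q then
      (f @^-1` `[ratr q, +oo[%classic) y -> zN (ratr q) y else True}.
    apply: ae_foralln => k; case: unpickle => [q|]; last exact: aeW.
    apply: (density_zero_density_ae d d2 leb omega Hleb _ _ _ _ (f @^-1` `[ratr q, +oo[%classic)).
      by rewrite -[X in measurable X]setTI; exact: mf.
    by move=> y /=; rewrite in_itv/= ?andbT => fy; apply/max_idPr; rewrite subr_le0.
  apply: filterS => y hy q; have := hy (pickle q); rewrite pickleK => {}hy fy.
  by apply: hy; rewrite /= in_itv/= ?andbT.
near=> y => beta b0 eps e0.
have nS : (~` S) y by near: y.
have zp : zero_density (jordan_pos hn) y by move: nS; near: y.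
have zm : zero_density (jordan_neg hn) y by move: nS; near: y.
(* One level just above f(y) for the upper bound and one just below for the lower bound. *)
have [q1 hq1] := @rat_in_itvoo R (f y) (f y + eps / 4) ltac:(by rewrite ltrDl divr_gt0).
have [q2 hq2] := @rat_in_itvoo R (f y - eps / 4) (f y) ltac:(by rewrite gtrDl oppr_lt0 divr_gt0).
move: hq1 hq2; rewrite !in_itv/= => /andP[fq1 q1f] /andP[q2f fq2].
have zP1 : zP (ratr q1) y.
  have H : forall q : rat, f y <= ratr q -> zP (ratr q) y by near: y.
  exact/H/ltW.
have zN2 : zN (ratr q2) y.
  have H : forall q : rat, ratr q <= f y -> zN (ratr q) y by near: y.
  exact/H/ltW.
have e4 : 0 < eps / 4 by rewrite divr_gt0.
have [D1 D10 hD1] := MH_kernel_vanish d alpha _ y d2 a1 zp beta b0 _ e4.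
have [D2 D20 hD2] := MH_kernel_vanish d alpha _ y d2 a1 zm beta b0 _ e4.
have [D3 D30 hD3] := density_kernel_vanish d alpha d2 a1 omega _ _ _ _ y zP1 beta b0 _ e4.
have [D4 D40 hD4] := density_kernel_vanish d alpha d2 a1 omega _ _ _ _ y zN2 beta b0 _ e4.
exists (Num.min (Num.min D1 D2) (Num.min D3 D4)); first by rewrite !lt_min D10 D20 D30 D40.
move=> x t t0 hbeta; rewrite !lt_min => /andP[/andP[l1 l2] /andP[l3 l4]].
have := hD1 x t t0 hbeta l1; have := hD2 x t t0 hbeta l2.
have := hD3 x t t0 hbeta l3; have := hD4 x t t0 hbeta l4.
have [M KM] := MH_kernel_bounded d alpha d2 a1 x t t0.
have shift q := charge_integral_shift omega f intf omT mu nu _ _ hn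
  (MH_kernel d alpha x t) M q muE (measurable_MH_kernel d alpha x t t0)
  (MH_kernel_ge0 d alpha x t) KM (integral_MH_kernel d alpha leb omega x t d2 a1 Hleb omE t0).
have [vp [vm [sp [sm [vpE vmE spE smE q1E]]]]] := shift (ratr q1).
have [vp' [vm' [sp' [sm' [vpE' vmE' spE' smE' q2E]]]]] := shift (ratr q2).
have vp'0 : 0 <= vp'.
  by rewrite -lee_fin -vpE'; apply: integral_ge0 => z _; rewrite lee_fin MH_kernel_ge0.
have sp'0 : 0 <= sp'.
  rewrite -lee_fin -spE'; apply: integral_ge0 => z _.
  by rewrite mule_ge0// lee_fin ?MH_kernel_ge0 ?excess_ge0.
have vm0 : 0 <= vm.
  by rewrite -lee_fin -vmE; apply: integral_ge0 => z _; rewrite lee_fin MH_kernel_ge0.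
have sm0 : 0 <= sm.
  rewrite -lee_fin -smE; apply: integral_ge0 => z _.
  by rewrite mule_ge0// lee_fin ?MH_kernel_ge0 ?deficit_ge0.
(* Above: MH <= q1 + vp + sp < f(y) + 3 eps/4, dropping the nonnegative vm and sm. Below: MH >= q2 -
   vm' - sm' > f(y) - 3 eps/4, dropping vp' and sp'. *)
rewrite smE' spE vmE' vpE !lee_fin -/(MH d alpha mu x t) in q1E q2E * => h4 h3 h2 h1.
rewrite ltr_norml; move: q1E q2E vp'0 sp'0 vm0 sm0 h4 h3 h2 h1 q1f q2f e4; clear; lra.
Unshelve. all: by end_near.
Qed.
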